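(* Let $D\subseteq\mathbb R^2$ be an admissible domain, let $\{D_N\}_{N\ge1}$ be admissible approximations of $D$, and let $h^{D_N}$ be the DGFF on $D_N$. Let $\{a_N\}_{N\ge1}$ be a positive sequence such that $\lambda:=\lim_{N\to\infty}\frac{a_N}{2\sqrt g\,\log N}$ exists and belongs to $(0,1)$, and set $K_N:=\frac{N^2}{\sqrt{\log N}}\,e^{-\frac{a_N^2}{2g\log N}}$. Then, as $N\to\infty$, $$\frac1{K_N}\#\bigl\{x\in D_N\colon h^{D_N}_x\ge a_N\bigr\}\;\longrightarrow\;(\alpha\lambda)^{-1}Z^D_\lambda(D)\quad\text{in law},$$ where $\alpha:=2/\sqrt g$.
   Context: Constants: $g:=\frac1{2\pi}$ and $\alpha:=2/\sqrt g$. Admissible domain: a bounded open set $D\subseteq\mathbb R^2$ whose boundary $\partial D$ has finitely many connected components, each of positive Euclidean diameter. Admissible approximations of $D$: nonempty sets $D_N\subseteq\mathbb Z^2$, $N\ge1$, such that $D_N\subseteq\{x\in\mathbb Z^2\colon d_\infty(x/N,\mathbb R^2\smallsetminus D)>1/N\}$ for all $N$ and, for each $\delta>0$, $D_N\supseteq\{x\in\mathbb Z^2\colon d_\infty(x/N,\mathbb R^2\smallsetminus D)>\delta\}$ for all sufficiently large $N$; here $d_\infty$ is the $\ell^\infty$-distance. Random walk and Green function: collapse all vertices of $\mathbb Z^2\smallsetminus D_N$ into one vertex $\varrho$, re-routing to $\varrho$ every edge of $\mathbb Z^2$ leaving $D_N$ (multiple edges kept). $X$ is the continuous-time simple random walk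 on the resulting graph with vertex set $D_N\cup\{\varrho\}$, making jumps at rate $1$; $P^x$ is its law started at $x$. With $H_\varrho:=\inf\{t\ge0\colon X_t=\varrho\}$ and $\pi(y)=4$ for $y\in D_N$, set $G^{D_N}(x,y):=\frac1{\pi(y)}\int_0^\infty P^x(X_t=y,\,H_\varrho>t)\,dt$. The DGFF on $D_N$ is the centered Gaussian process $\{h^{D_N}_x\}_{x\in D_N}$ with covariance $E(h^{D_N}_xh^{D_N}_y)=G^{D_N}(x,y)$. The measures $Z^D_\lambda$: $\{Z^D_\lambda\colon\lambda\in(0,1)\}$ is the family of a.s.-finite random Borel measures on $D$ whose laws are characterized by the following known limit theorem: for any admissible approximations $\{D_N\}$ of $D$ and any positive sequence $\{a_N\}$ with $\frac{a_N}{2\sqrt g\log N}\to\lambda\in(0,1)$, and $K_N:=\frac{N^2}{\sqrt{\log N}}e^{-a_N^2/(2g\log N)}$, the random measures $\frac1{K_N}\sum_{x\in D_N}\delta_{x/N}\otimes\delta_{h^{D_N}_x-a_N}$ converge in law, relative to the vague topology on $\overline D\times\mathbb R$, to $Z^D_\lambda(dx)\otimes e^{-\alpha\lambda h}dh$. *)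

(* Defs.v *)
From HB Require Import structures.
From mathcomp Require Import all_boot all_order all_algebra.
From mathcomp Require Import finmap.
From mathcomp Require Import all_classical all_reals all_analysis.
From mathcomp Require Import measurable_realfun.

Set Implicit Arguments.
Unset Strict Implicit.
Unset Printing Implicit Defensive.

Import Order.TTheory GRing.Theory Num.Theory.
Import numFieldNormedType.Exports.

Local Open Scope classical_set_scope.
Local Open Scope ring_scope.

Definition gconst (R : realType) : R := (2 * pi)^-1.
Definition alphac (R : realType) : R := 2 / Num.sqrt (gconst R).

Notation Z2 := (int * int)%type.

(* Cardinality of a finite set (0 if the set is infinite). *)
Definition ncard (T : choiceType) (A : set T) : nat := #|` fset_set A|.

Section domains.
Context {R : realType}.
Local Open Scope ereal_scope.

Definition edist2 (x y : R * R) : R :=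
  Num.sqrt ((x.1 - y.1) ^+ 2 + (x.2 - y.2) ^+ 2)%R.

Definition diameter (A : set (R * R)) : \bar R :=
  ereal_sup [set (edist2 xy.1 xy.2)%:E | xy in A `*` A].

Definition boundary (D : set (R * R)) : set (R * R) := closure D `\` interior D.

Definition components (A : set (R * R)) : set (set (R * R)) :=
  [set connected_component A x | x in A].

Definition admissible_domain (D : set (R * R)) : Prop :=
  [/\ bounded_set D, open D, finite_set (components (boundary D)) &
      forall C, components (boundary D) C -> 0 < diameter C].

(* The point x / N. *)
Definition scaled (N : nat) (x : Z2) : R * R :=
  (x.1%:~R / N%:R, x.2%:~R / N%:R)%R.

(* The balls of R * R are squares, so that edist_inf is the distance to a set
   in the sup norm. *)
Definition admissible_approx (D : set (R * R)) (DN : nat -> set Z2) : Prop :=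
  [/\ forall N, (0 < N)%N -> DN N !=set0,
      forall N, (0 < N)%N ->
        DN N `<=` [set x | (N%:R^-1)%:E < edist_inf (~` D) (scaled N x)] &
      forall delta : R, (0 < delta)%R -> \forall N \near \oo,
        [set x | delta%:E < edist_inf (~` D) (scaled N x)] `<=` DN N].

End domains.

(* [Some x] is a lattice site and [None] is the collapsed vertex rho. *)
Notation vertex := (option (int * int)).

Section random_walk.
Context {R : realType}.

Definition neighbours (x y : Z2) : Prop := `|x.1 - y.1| + `|x.2 - y.2| = 1.

(* Number of edges between two vertices of the collapsed graph; the sites
   outside D, which are not vertices of this graph, are left isolated. *)
Definition edges (D : set Z2) (u v : vertex) : nat :=
  match u, v with
  | Some x, Some y => `[< [/\ D x, D y & neighbours x y] >]
  | Some x, None => ncard [set z | [/\ D x, ~ D z & neighbours x z]]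
  | None, Some y => ncard [set z | [/\ D y, ~ D z & neighbours y z]]
  | None, None => 0
  end.

Definition degree (D : set Z2) (u : vertex) : nat :=
  (\sum_(v \in [set: vertex]) edges D u v)%N.

Definition jump_prob (D : set Z2) (u v : vertex) : R :=
  (edges D u v)%:R / (degree D u)%:R.

(* Continuous-time simple random walk jumping at rate 1, where [P x] is the law
   of the walk started at x: Y is the sequence of the visited vertices and W
   that of the holding times, which are i.i.d. exponential with parameter 1 and
   independent of Y. *)
Definition ctime_srw (D : set Z2) d (Omega : measurableType d)
    (P : Z2 -> probability Omega R) (X : R -> Omega -> vertex) : Prop :=
  exists (Y : nat -> Omega -> vertex) (W : nat -> {mfun Omega >-> R}),
  [/\ forall n v, measurable (Y n @^-1` [set v]),
      forall w, (forall n, 0 < W n w) /\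
        (\sum_(0 <= k < n) W k w @[n --> \oo] --> +oo),
      forall x, D x -> forall (n : nat) (y : nat -> vertex) (s : nat -> R),
        (forall i, 0 <= s i) ->
        P x [set w | forall i, (i <= n)%N -> Y i w = y i /\ s i < W i w] =
        ((y 0%N == Some x)%:R *
          (\prod_(0 <= i < n) jump_prob D (y i) (y i.+1)) *
          \prod_(0 <= i < n.+1) expR (- s i))%:E &
      forall n w (t : R),
        \sum_(0 <= k < n) W k w <= t < \sum_(0 <= k < n.+1) W k w ->
        X t w = Y n w].

Definition hitting_time (Omega : Type) (X : R -> Omega -> vertex) (w : Omega) :
    \bar R :=
  ereal_inf [set t%:E | t in [set t : R | 0 <= t /\ X t w = None]].

(* The law of the walk, hence the right-hand side, is determined by D. *)
Definition green_function (D : set Z2) (G : Z2 -> Z2 -> R) : Prop :=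
  exists d (Omega : measurableType d) (P : Z2 -> probability Omega R)
    (X : R -> Omega -> vertex),
  ctime_srw D P X /\
  forall x y, D x -> D y ->
    (G x y)%:E = (4^-1%:E * \int[lebesgue_measure]_(t in `[0%R, +oo[)
      P x [set w | X t w = Some y /\ (t%:E < hitting_time X w)%E])%E.

End random_walk.

Section dgff.
Context {R : realType}.

(* normal_prob is not a Dirac mass when its variance vanishes. *)
Definition normal_law (m s : R) (A : set R) : \bar R :=
  if s == 0 then \d_m A else normal_prob m s A.

Definition gaussian_process (I : Type) (D : set I) d (Omega : measurableType d)
    (P : probability Omega R) (h : I -> {RV P >-> R}) : Prop :=
  forall n (x : 'I_n -> I) (c : 'I_n -> R), (forall i, D (x i)) ->
  exists m s : R, 0 <= s /\
    forall A : set R, measurable A ->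
      P ((fun w => \sum_(i < n) c i * h (x i) w) @^-1` A) = normal_law m s A.

(* The variables h x with x outside D play no role. *)
Definition DGFF (D : set Z2) d (Omega : measurableType d)
    (P : probability Omega R) (h : Z2 -> {RV P >-> R}) : Prop :=
  exists2 G : Z2 -> Z2 -> R, green_function D G &
  [/\ gaussian_process D h,
      forall x, D x -> 'E_P[h x]%E = 0%E &
      forall x y, D x -> D y -> covariance P (h x) (h y) = (G x y)%:E].

End dgff.

(* Convergence in law of random elements of T whose values lie (almost surely,
   for the limit) in the subspace M of T. *)
Definition cvg_in_law (R : realType) (T : topologicalType) (M : set T)
    (d : nat -> measure_display) (Omega : forall N, measurableType (d N))
    (P : forall N, probability (Omega N) R) (X : forall N, Omega N -> T)
    d' (Omega' : measurableType d') (P' : probability Omega' R)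
    (Xlim : Omega' -> T) : Prop :=
  forall F : T -> R, {within M, continuous F} ->
    (exists C : R, forall m, M m -> `|F m| <= C) ->
    'E_(P N)[F \o X N]%E @[N --> \oo] --> 'E_P'[F \o Xlim]%E.

Section vague_topology.
Context {R : realType}.

Definition measure3 : Type := {measure set (R * R * R) -> \bar R}.
HB.instance Definition _ := gen_eqMixin measure3.
HB.instance Definition _ := gen_choiceMixin measure3.

Variable K : set (R * R).

(* Continuous functions with compact support on K * R, seen as functions on
   R^3 whose values outside of K * R are irrelevant. *)
Definition test_function (f : R * R * R -> R) : Prop :=
  {within K `*` setT, continuous f} /\
  exists C, [/\ compact C, C `<=` K `*` setT &
    forall z, (K `*` setT) z -> ~ C z -> f z = 0].

Definition test_functions : Type := {f | test_function f}.
HB.instance Definition _ := gen_eqMixin test_functions.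
HB.instance Definition _ := gen_choiceMixin test_functions.

Definition test_integrals (mu : measure3) : {ptws test_functions -> R} :=
  fun f => \int[mu]_(z in K `*` setT) sval f z.

Definition vague : Type := initial_topology test_integrals.
HB.instance Definition _ := Topological.on vague.

(* The Radon measures on K * R, seen as measures on R^3. *)
Definition radon : set vague :=
  [set mu : vague | (mu : measure3) (~` (K `*` setT)) = 0%E /\
    forall C, compact C -> ((mu : measure3) C < +oo)%E].

End vague_topology.
Arguments test_functions {R} K.
Arguments radon {R} K.

Section sum_dirac.
Context {R : realType} (I : choiceType) d (T : measurableType d).
Variables (A : set I) (p : I -> T).

Definition sum_dirac (B : set T) : \bar R := \esum_(x in A) \d_(p x) B.

Let sum_dirac0 : sum_dirac set0 = 0%E.
Proof. by rewrite /sum_dirac esum1// => x _; rewrite measure0. Qed.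

Let sum_dirac_ge0 B : (0 <= sum_dirac B)%E.
Proof. by apply: esum_ge0 => x _. Qed.

Let sum_dirac_sigma_additive : semi_sigma_additive sum_dirac.
Proof.
move=> F mF tF mUF.
suff -> : sum_dirac (\bigcup_n F n) = (\sum_(n <oo) sum_dirac (F n))%E.
  apply: is_cvg_nneseries => n _ _; exact: sum_dirac_ge0.
rewrite nneseries_esumT; last by move=> n; exact: sum_dirac_ge0.
rewrite /sum_dirac (esum_esum (J := fun=> A)
  (a := fun n x => \d_(p x) (F n) : \bar R))//.
rewrite (reindex_esum (A `*` setT) _ (fun x => (x.2, x.1)))//=; last first.
  split=> //=; first by move=> [x n] [/= Ax _].
    by move=> [x1 n1] [x2 n2] /= _ _ [] -> ->.
  by move=> [n x] [/= _ Ax]; exists (x, n).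
rewrite -(esum_esum (J := fun=> setT)
  (a := fun x n => \d_(p x) (F n) : \bar R))//.
apply: eq_esum => x Ax; rewrite -nneseries_esumT//.
rewrite (measure_bigcup (\d_(p x)) setT)//=.
by apply: eq_eseriesl => n; rewrite in_setT.
Qed.

HB.instance Definition _ := isMeasure.Build _ _ _ sum_dirac
  sum_dirac0 sum_dirac_ge0 sum_dirac_sigma_additive.

End sum_dirac.

Section exp_measure.
Context {R : realType}.
Variable c : R.

(* The measure e^(- c h) dh on the real line. *)
Definition exp_measure (B : set R) : \bar R :=
  (\int[lebesgue_measure]_(h in B) (expR (- (c * h)))%:E)%E.

Let exp_measure0 : exp_measure set0 = 0%E.
Proof. by rewrite /exp_measure integral_set0. Qed.

Let exp_measure_ge0 B : (0 <= exp_measure B)%E.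
Proof. by apply: integral_ge0 => h _; rewrite lee_fin expR_ge0. Qed.

Let cts_exp : continuous (fun h : R => expR (- (c * h))).
Proof.
move=> h; apply: (@continuous_comp _ _ _ (fun h : R => - (c * h)) expR).
  by apply: cvgN; apply: cvgM; [exact: cvg_cst|exact: cvg_id].
exact: continuous_expR.
Qed.

Let meas_exp (B : set R) :
  measurable_fun B (EFin \o (fun h : R => expR (- (c * h)))).
Proof.
apply/measurable_EFinP/(measurable_funS measurableT)=> //.
exact: continuous_measurable_fun.
Qed.

Let exp_measure_sigma_additive : semi_sigma_additive exp_measure.
Proof.
move=> F mF tF mUF.
suff -> : exp_measure (\bigcup_n F n) = (\sum_(n <oo) exp_measure (F n))%E.
  apply: is_cvg_nneseries => n _ _; exact: exp_measure_ge0.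
apply: ge0_integral_bigcup => //; exact: meas_exp.
Qed.

HB.instance Definition _ := isMeasure.Build _ _ _ exp_measure
  exp_measure0 exp_measure_ge0 exp_measure_sigma_additive.

Let exp_measure_sigma_finite : sigma_finite setT exp_measure.
Proof.
exists (fun n => `[- n%:R, n%:R]%classic).
  apply/seteqP; split=> // h _.
  have [n hn] : exists n : nat, `|h| <= n%:R.
    exists (Num.truncn `|h|).+1; exact/ltW/truncnS_gt.
  by exists n => //=; rewrite in_itv/= -ler_norml.
move=> n; split; first exact: measurable_itv.
suff : lebesgue_measure.-integrable `[- n%:R, n%:R]%classic
    (EFin \o (fun h : R => expR (- (c * h)))).
  move/integral_fune_lt_pinfty; exact.
apply: continuous_compact_integrable; first exact: segment_compact.
exact: continuous_subspaceT.
Qed.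

HB.instance Definition _ := Measure_isSigmaFinite.Build _ _ _ exp_measure
  exp_measure_sigma_finite.

End exp_measure.

Section thick_points.
Context {R : realType}.

Definition KN (a : nat -> R) (N : nat) : R :=
  N%:R ^+ 2 / Num.sqrt (ln N%:R) *
    expR (- (a N ^+ 2 / (2 * gconst R * ln N%:R))).

Lemma KN_ge0 a N : 0 <= (KN a N)^-1.
Proof.
by rewrite invr_ge0 mulr_ge0 ?expR_ge0// divr_ge0 ?exprn_ge0 ?sqrtr_ge0.
Qed.

Definition level_sequence (lambda : R) (a : nat -> R) : Prop :=
  (forall N, (0 < N)%N -> 0 < a N) /\
  (a N / (2 * Num.sqrt (gconst R) * ln N%:R) @[N --> \oo] --> lambda).

Definition thick_point_measure (D : set Z2) (a : nat -> R) (N : nat)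
    (h : Z2 -> R) : measure3 :=
  mscale (NngNum (KN_ge0 a N))
    (sum_dirac D (fun x => (scaled N x, h x - a N))).

(* Z is a random measure on D, seen as a random measure on R^2, whose law is
   that of Z^D_lambda. *)
Definition is_ZD (D : set (R * R)) (lambda : R) d' (Omega' : measurableType d')
    (P' : probability Omega' R) (Z : R.-ker Omega' ~> (R * R)%type) : Prop :=
  [/\ forall w, Z w (~` D) = 0%E,
      {ae P', forall w, (Z w D < +oo)%E} &
      forall (DN : nat -> set Z2) (a : nat -> R) (d : nat -> measure_display)
        (Omega : forall N, measurableType (d N))
        (P : forall N, probability (Omega N) R)
        (h : forall N, Z2 -> {RV (P N) >-> R}),
      admissible_approx D DN -> level_sequence lambda a ->
      (forall N, (0 < N)%N -> DGFF (DN N) (h N)) ->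
      cvg_in_law (T := vague (closure D)) (radon (closure D)) P
        (fun N w => thick_point_measure (DN N) a N (fun x => h N x w))
        P' (fun w => (Z w \x exp_measure (alphac R * lambda))%E : measure3)].

End thick_points.

(* Main.v *)
Require Import Defs.
From mathcomp Require Import all_boot all_order all_algebra.
From mathcomp Require Import finmap.
From mathcomp Require Import all_classical all_reals all_analysis.
From mathcomp Require Import measurable_realfun.
From mathcomp Require Import zify ring lra.

(** The number of points with height at least a_N, divided by K_N, is the mass that
the point measure of the limit theorem gives to closure(D) x [0, +oo[, and the
limiting measure gives to this set the mass Z(D) times the integral of
exp(- alpha lambda h) over h >= 0, that is Z(D) / (alpha lambda). The limit theorem
does not apply to it directly: it is stated for the vague topology on
closure(D) x R, whose test functions have compact support, so that mass could
escape to height +oo or sit at height 0. The indicator of [0, +oo[ is therefore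
replaced by compactly supported continuous functions of the height (bump), for
which the limit theorem gives the convergence in law, and the error is controlled
in mean, uniformly in N (cvg_in_law_approx).

The control of the error is a first moment computation (DGFF_tails). Each h_x is a
centred Gaussian variable of variance G(x,x) (centered_normal_law), and
G(x,x) <= g log N + O(1) implies that its density at a_N + y is at most
C (K_N / N^2) exp(- c y) for y >= -1 (thick_density_le). Summing over the O(N^2) sites,
the expected normalised number of points above a_N + k is O(exp(- c k)), and the
expected normalised number of points between a_N - 1/k and a_N is O(1/k).

The bound on G(x,x) (green_function_diag_le) is proved without the potential kernel.
G(x,x) is at most one fourth of the sum over n of the probability that the
discrete walk from x is back at x at time n without having left D_N
(integral_alive_le). Up to time 2 N^2 this probability is at most that of the walk
on the whole lattice, which at time 2k is the square of C(2k,k) / 4^k, hence at most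
1 / (pi k) by Wallis' argument (central_bin_prob_sqr); this yields
(1/4) (1/pi) log N^2 = g log N up to O(1). After time 2 N^2 the probability of being
at x is O(N^-2) times the probability of having survived 2 N^2 steps less, and the
latter sums to the mean exit time, which is O(N^2) (sum_survival_le). *)

Set Implicit Arguments.
Unset Strict Implicit.
Unset Printing Implicit Defensive.

Import Order.TTheory GRing.Theory Num.Theory.
Import numFieldNormedType.Exports.

Local Open Scope classical_set_scope.
Local Open Scope ring_scope.

(** * Wallis' bound for the central binomial probability *)

Section wallis.
Context {R : realType}.

(** The recursion is the integration by parts for the integral of the powers of
sin; having a closed primitive reduces Wallis' argument to derivatives. The
constants are chosen so that every primitive vanishes at 0. *)
Fixpoint sin_primitive (n : nat) (x : R) : R :=
  match n with
  | 0 => x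
  | 1 => 1 - cos x
  | n'.+2 => (n'.+1%:R * sin_primitive n' x - cos x * sin x ^+ n'.+1) / n'.+2%:R
  end.

Lemma is_derive_sin_primitive n (x : R) :
  is_derive x 1 (sin_primitive n) (sin x ^+ n).
Proof.
elim/ltn_ind: n => -[|[|n]] IH; rewrite /=.
- by rewrite expr0; exact: is_derive_id.
- rewrite expr1 (_ : (fun x0 : R => 1 - cos x0) = cst 1 - cos)//.
  by apply: is_derive_eq; rewrite add0r opprK.
have -> : (fun x : R => (n.+1%:R * sin_primitive n x - cos x * sin x ^+ n.+1) / n.+2%:R)
  = (n.+2%:R)^-1 \*: (n.+1%:R \*: sin_primitive n - cos * (sin ^+ n.+1)).
  by apply/funext => y /=; rewrite !fctE mulrC.
have Hn := IH n (ltnW (ltnSn _)).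
apply: is_derive_eq => /=.
rewrite !fctE /GRing.scale/=.
have -> : cos x * (n.+1%:R * sin x ^+ n * cos x) =
    n.+1%:R * sin x ^+ n * (1 - sin x ^+ 2).
  by rewrite -(cos2Dsin2 x); ring.
have n0 : n.+2%:R != 0 :> R by rewrite pnatr_eq0.
apply: (mulfI n0); rewrite mulVKf// !exprS -[n.+2%:R]natr1; ring.
Qed.

Lemma sin_primitive0 n : sin_primitive n (0:R) = 0.
Proof.
elim/ltn_ind: n => -[|[|n]] IH; rewrite /= ?cos0 ?subrr//.
by rewrite IH ?(ltnW (ltnSn _))// sin0 expr0n/= !mulr0 subrr mul0r.
Qed.

Let w n := sin_primitive n (pi / 2 : R).

Lemma wS n : w n.+2 = n.+1%:R / n.+2%:R * w n.
Proof. by rewrite /w /= cos_pihalf mul0r subr0; ring. Qed.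

(** The difference of two consecutive primitives is monotone on [0, pi/2],
because 0 <= sin <= 1 there. *)
Lemma w_decr n : w n.+1 <= w n.
Proof.
pose f x : R := sin_primitive n.+1 x - sin_primitive n x.
have df (x : R) : is_derive x 1 f (sin x ^+ n.+1 - sin x ^+ n).
  have H1 := is_derive_sin_primitive n.+1 x.
  have H2 := is_derive_sin_primitive n x.
  exact: is_deriveB.
have pi0 : 0 <= pi / 2 :> R by rewrite divr_ge0// pi_ge0.
have : f (pi / 2) <= f 0.
  apply: (@ler0_derive1_le_cc R f 0 (pi/2)) => //.
  - move=> x; rewrite in_itv/= => /andP[x0 xp].
    rewrite derive1E (@derive_val _ _ _ _ _ _ _ (df x)) exprS -{2}[sin x ^+ n]mul1r -mulrBl.
    rewrite mulr_le0_ge0// ?subr_le0 ?sin_le1// exprn_ge0// sin_ge0_pi//.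
    by rewrite (ltW x0)/=; have := pi_ge0 R; lra.
  - apply: derivable_within_continuous => x _; apply: ex_derive.
  - by rewrite in_itv/= lexx pi0.
  - by rewrite in_itv/= lexx pi0.
by rewrite /f !sin_primitive0 subrr subr_le0.
Qed.

(** The product telescopes, and this is where pi enters. *)
Lemma w_prod n : n.+1%:R * (w n.+1 * w n) = pi / 2.
Proof.
elim: n => [|n IH]; first by rewrite /w /= cos_pihalf subr0 !mul1r.
rewrite -IH wS; have n0 : n.+2%:R != 0 :> R by rewrite pnatr_eq0.
by field.
Qed.

Lemma w_ge0 n : 0 <= w n.
Proof.
elim/ltn_ind: n => -[|[|n]] IH; first by rewrite /w /= divr_ge0 ?pi_ge0.
  by rewrite /w /= cos_pihalf subr0.
by rewrite wS mulr_ge0 ?divr_ge0// IH// ltnW.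
Qed.

(** Probability that the simple random walk on the integers is back at its
starting point at time 2k. *)
Definition central_bin_prob (k : nat) : R := 'C(k.*2, k)%:R / 2 ^+ k.*2.

Lemma w_even k : w k.*2 = pi / 2 * central_bin_prob k.
Proof.
elim: k => [|k IH].
  by rewrite /w/= /central_bin_prob double0 bin0 expr0 divr1 mulr1.
rewrite doubleS wS IH /central_bin_prob doubleS !exprS.
have H1 : 'C(k.*2.+2, k.+1)%:R * k.+1%:R = 'C(k.*2, k)%:R * (k.*2.+1%:R * 2) :> R.
  rewrite -!natrM; congr (_%:R).
  have E1 := mul_bin_diag k.*2.+1 k.
  have : 'C(k.*2.+1, k) = 'C(k.*2.+1, k.+1).
    by rewrite -bin_sub; [congr ('C(_, _)); lia|lia].
  move: E1 => /=; rewrite (binS k.*2.+1 k) => + ->.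
  move: ('C(_, _)) ('C(_, _)) => u v E1; rewrite mulnDl mulnC -E1; lia.
have k1 : k.*2.+2%:R != 0 :> R by rewrite pnatr_eq0.
have -> : 'C(k.*2.+2, k.+1)%:R = 'C(k.*2, k)%:R * (k.*2.+1%:R * 2) / k.+1%:R :> R.
  by rewrite -H1 mulfK// pnatr_eq0.
have -> : k.*2.+2%:R = 2 * k.+1%:R :> R by rewrite -doubleS -muln2 natrM mulrC.
have e0 : (2 : R) ^+ k.*2 != 0 by rewrite expf_neq0.
have k3 : k.+1%:R != 0 :> R by rewrite pnatr_eq0.
move: e0 k3; move: (2 ^+ k.*2) (k.*2.+1%:R) (k.+1%:R) ('C(k.*2, k)%:R).
by move=> e q j c e0 j0; field; rewrite e0 j0.
Qed.

(** The constant 1/pi is sharp, and it is what produces the constant g = 1/(2 pi)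
in front of the logarithm in the bound on the Green function. *)
Lemma central_bin_prob_sqr k : (0 < k)%N ->
  central_bin_prob k ^+ 2 <= (pi * k%:R)^-1.
Proof.
case: k => // k _.
have H := w_prod k.*2.+1; have M := w_decr k.*2.+1.
rewrite -doubleS in H M.
have p0 := @pi_gt0 R.
have : k.+1.*2%:R * w k.+1.*2 ^+ 2 <= pi / 2.
  rewrite -H expr2 ler_wpM2l// ler_wpM2l//; exact: w_ge0.
rewrite w_even -muln2 natrM.
set c := central_bin_prob _ => hc.
have k3 : 0 < k.+1%:R :> R by rewrite ltr0n.
rewrite -[leRHS]div1r ler_pdivlMr ?mulr_gt0//.
rewrite -(ler_pM2l (_ : 0 < pi / 2)); last by rewrite divr_gt0.
rewrite mulr1; apply: le_trans hc; rewrite le_eqVlt; apply/orP; left; apply/eqP; by field.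
Qed.

Lemma central_bin_prob_ge0 k : 0 <= central_bin_prob k.
Proof. by rewrite divr_ge0. Qed.

Lemma leq_bin_central k i : ('C(k.*2, i) <= 'C(k.*2, k))%N.
Proof.
have H j : (j <= k)%N -> ('C(k.*2, k - j) <= 'C(k.*2, k))%N.
  elim: j => [|j IH] jk; first by rewrite subn0.
  apply: leq_trans (IH (ltnW jk)).
  have := mul_bin_left k.*2 (k - j.+1).
  have -> : (k - j.+1).+1 = (k - j)%N by lia.
  move: ('C(_, _)) ('C(_, _)) => x y; nia.
have [ik|ki] := leqP i k; first by rewrite -(subKn ik) H// leq_subr.
have [i2|i2] := leqP i k.*2; last by rewrite bin_small.
by rewrite -bin_sub// (_ : k.*2 - i = k - (i - k))%N ?H; lia.
Qed.

Lemma sum_inv_le_ln n : (0 < n)%N -> \sum_(1 <= k < n) (k%:R)^-1 <= 1 + ln n%:R :> R.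
Proof.
case: n => // -[_|n _]; first by rewrite big_geq// ln1 addr0.
suff H : \sum_(1 <= k < n.+2) (k%:R)^-1 <= 1 + ln n.+1%:R :> R.
  by apply: le_trans H _; rewrite lerD2l ler_ln ?posrE ?ltr0n// ler_nat.
elim: n => [|n IH]; first by rewrite big_nat1 invr1 lerDl ln_ge0// ler1n.
rewrite big_nat_recr//=.
have n0 : 0 < n.+2%:R :> R by rewrite ltr0n.
have n1 : 0 < n.+1%:R :> R by rewrite ltr0n.
have H : n.+2%:R^-1 <= ln n.+2%:R - ln n.+1%:R :> R.
  rewrite -ln_div// -[leRHS]opprK -lnV ?posrE ?divr_gt0// invf_div lerNr.
  have -> : n.+1%:R / n.+2%:R = 1 + (- (n.+2%:R^-1)) :> R.
    apply: (mulIf (lt0r_neq0 n0)).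
    by rewrite divfK ?gt_eqF// mulrBl mulVf ?gt_eqF// mul1r -[n.+2%:R]natr1 addrK.
  by rewrite le_ln1Dx// ltrN2 invf_lt1// ltr1n.
by apply: le_trans (lerD IH H) _; rewrite -addrA (addrCA (ln n.+1%:R)) subrr addr0.
Qed.

End wallis.

(** * The discrete-time walk killed outside of a domain *)
Section killed_walk.
Context {R : realType}.

Definition walk_avg (f : Z2 -> R) (x : Z2) : R :=
  (f (x.1 + 1, x.2) + f (x.1 - 1, x.2) + f (x.1, x.2 + 1) + f (x.1, x.2 - 1)) / 4.

Lemma ler_walk_avg f1 f2 x : (forall y, f1 y <= f2 y) ->
  walk_avg f1 x <= walk_avg f2 x.
Proof. by move=> f12; rewrite ler_wpM2r// !lerD. Qed.

Lemma walk_avg_ge0 f x : (forall y, 0 <= f y) -> 0 <= walk_avg f x.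
Proof. by move=> f0; rewrite divr_ge0// !addr_ge0. Qed.

Lemma walk_avgZ c f x : walk_avg (fun y => c * f y) x = c * walk_avg f x.
Proof. by rewrite /walk_avg; ring. Qed.

Fixpoint walk1 (n : nat) (j : int) : R :=
  if n is n'.+1 then (walk1 n' (j - 1) + walk1 n' (j + 1)) / 2
  else (j == 0)%:R.

(** n + j is twice the number of steps to the right, hence must be even and
nonnegative. *)
Lemma walk1E n j : walk1 n j =
  if n%:Z + j is Posz m then (~~ odd m)%:R * 'C(n, m./2)%:R / 2 ^+ n else 0.
Proof.
elim: n j => [|n IH] j.
  rewrite /= add0r; case: j => [[|[|m]]|m] //=; rewrite ?mul0r ?bin0 ?mul1r ?divr1//.
  - by rewrite expr0 invr1.
  - by rewrite bin0n/= mulr0.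
rewrite /= !IH.
have -> : n%:Z + (j - 1) = n.+1%:Z + j - 2 by lia.
have -> : n%:Z + (j + 1) = n.+1%:Z + j by lia.
case: (n.+1%:Z + j) => [[|[|m]]|m].
- by rewrite /= !bin0 add0r exprS; field.
- by rewrite /= !mul0r addr0 mul0r.
- have -> : m.+2%:Z - 2 = m by lia.
  rewrite /= negbK binS exprS natrD; have n0 : (2 : R) ^+ n != 0 by rewrite expf_neq0.
  by field.
- have -> : Negz m - 2 = Negz m.+2 by lia.
  by rewrite addr0 mul0r.
Qed.

Lemma walk1_ge0 n j : 0 <= walk1 n j.
Proof. by elim: n j => //= n IH j; rewrite divr_ge0// addr_ge0. Qed.

Lemma walk1_even_le k j : walk1 k.*2 j <= central_bin_prob k.
Proof.
rewrite walk1E; case: (_ + _) => m; last exact: central_bin_prob_ge0.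
rewrite ler_wpM2r// ?invr_ge0 ?exprn_ge0//.
apply: (@le_trans _ _ ('C(k.*2, m./2)%:R)); last by rewrite ler_nat leq_bin_central.
by case: odd; rewrite /= ?mul0r ?mul1r.
Qed.

Lemma walk1_odd0 n : odd n -> walk1 n 0 = 0.
Proof. by move=> on; rewrite walk1E addr0 on !mul0r. Qed.

(** The coordinates u.1 + u.2 and u.1 - u.2 of the simple random walk on the
square lattice are two independent simple random walks on the integers. *)
Definition walk2 n (u : Z2) := walk1 n (u.1 + u.2) * walk1 n (u.1 - u.2).

Lemma walk2S n u : walk2 n.+1 u = walk_avg (walk2 n) u.
Proof.
case: u => a b; rewrite /walk_avg /walk2 /=.
have -> : a + 1 + b = a + b + 1 by lia.
have -> : a + 1 - b = a - b + 1 by lia.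
have -> : a - 1 + b = a + b - 1 by lia.
have -> : a - 1 - b = a - b - 1 by lia.
have -> : a + (b + 1) = a + b + 1 by lia.
have -> : a - (b + 1) = a - b - 1 by lia.
have -> : a + (b - 1) = a + b - 1 by lia.
have -> : a - (b - 1) = a - b + 1 by lia.
by field.
Qed.

Variable D : set Z2.

(** Probability that the walk started at x is at y after n steps and has been in
D at the times 0, ..., n - 1; the recursion is on the first step. *)
Fixpoint killed_walk (n : nat) (x y : Z2) : R :=
  if n is n'.+1 then (x \in D)%:R * walk_avg (killed_walk n' ^~ y) x
  else (x == y)%:R.

Fixpoint survival (n : nat) (x : Z2) : R :=
  (x \in D)%:R * (if n is n'.+1 then walk_avg (survival n') x else 1).

Lemma killed_walk_ge0 n x y : 0 <= killed_walk n x y.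
Proof.
by elim: n x => //= n IH x; rewrite mulr_ge0// walk_avg_ge0.
Qed.

Lemma killed_walk_le_walk2 n x y : killed_walk n x y <= walk2 n (x.1 - y.1, x.2 - y.2).
Proof.
elim: n x => [|n IH] x.
  rewrite /walk2/=; have [->|_] := eqVneq x y; last by rewrite mulr_ge0.
  by rewrite !subrr eqxx mul1r.
rewrite walk2S/=; apply: (@le_trans _ _ (walk_avg (killed_walk n ^~ y) x)).
  by rewrite ler_piMl ?lern1 ?leq_b1// walk_avg_ge0// => z; exact: killed_walk_ge0.
apply: le_trans (ler_walk_avg _ IH) _; rewrite /walk_avg/=.
have -> : x.1 + 1 - y.1 = x.1 - y.1 + 1 by lia.
have -> : x.1 - 1 - y.1 = x.1 - y.1 - 1 by lia.
have -> : x.2 + 1 - y.2 = x.2 - y.2 + 1 by lia.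
by have -> : x.2 - 1 - y.2 = x.2 - y.2 - 1 by lia.
Qed.

(** The walk survives its first m steps, and then reaches y in 2k further steps
with probability at most the maximum of the free heat kernel. *)
Lemma killed_walk_even_le k m x y : (0 < k)%N ->
  killed_walk (m + k.*2) x y <= central_bin_prob k ^+ 2 * survival m x.
Proof.
move=> k0; elim: m x => [|m IH] x.
  rewrite add0n /=; have [xD|xD] := boolP (x \in D); last first.
    rewrite mul0r mulr0; case: k k0 => // k _.
    by rewrite doubleS /= (negbTE xD) mul0r.
  rewrite !mulr1 expr2; apply: le_trans (killed_walk_le_walk2 _ _ _) _.
  by rewrite ler_pM ?walk1_ge0 ?walk1_even_le.
rewrite addSn /= [leRHS]mulrCA ler_wpM2l// -walk_avgZ.
exact: ler_walk_avg.
Qed.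

(** The sum bounds the mean exit time from D. The function 2r + 2 - |y|^2 loses 1
in the mean at each step, and it is still nonnegative at the neighbours of D. *)
Lemma sum_survival_le (r : R) M x :
  (forall y, D y -> y.1%:~R ^+ 2 + y.2%:~R ^+ 2 <= r) -> D x ->
  \sum_(m < M) survival m x <= 2 * r + 2.
Proof.
move=> Dr Dx.
pose V (y : Z2) : R := 2 * r + 2 - (y.1%:~R ^+ 2 + y.2%:~R ^+ 2).
suff H y : D y -> \sum_(m < M) survival m y <= V y.
  apply: le_trans (H _ Dx) _; rewrite lerBlDr lerDl addr_ge0 ?sqr_ge0//.
elim: M y => [|M IH] y Dy.
  rewrite big_ord0 /V; have := Dr _ Dy.
  have := sqr_ge0 (y.1%:~R : R); have := sqr_ge0 (y.2%:~R : R); lra.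
have V0 z : D z \/ ~ D z by exact: EM.
have IH' z : 0 <= V z -> \sum_(m < M) survival m z <= V z.
  move=> Vz; case: (V0 z) => Dz; first exact: IH.
  rewrite big1// => m _; case: (m : nat) => [|k] /=; rewrite memNset// mul0r//.
rewrite big_ord_recl; under eq_bigr => i _ do rewrite lift0.
rewrite [survival _ _]/= mulr1 mem_set//.
have -> : \sum_(i < M) survival i.+1 y = walk_avg (fun z => \sum_(m < M) survival m z) y.
  rewrite /walk_avg -!big_split /= mulr_suml; apply: eq_bigr => i _.
  by rewrite mem_set// mul1r.
have -> : V y = 1 + walk_avg V y.
  by rewrite /V /walk_avg /= !rmorphD /= rmorphN /= ; field.
rewrite lerD2l /walk_avg ler_wpM2r//.
have H := Dr _ Dy; case: y H Dy => a b /= H Dy.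
have A1 := sqr_ge0 (a%:~R - 1 : R); have A2 := sqr_ge0 (a%:~R + 1 : R).
have B1 := sqr_ge0 (b%:~R - 1 : R); have B2 := sqr_ge0 (b%:~R + 1 : R).
have A0 := sqr_ge0 (a%:~R : R); have B0 := sqr_ge0 (b%:~R : R).
rewrite !lerD//; apply: IH'; rewrite /V/= ?rmorphD ?rmorphN /=; nra.
Qed.

(** Times before 2T are compared with the walk on the whole lattice, which
returns at even times only; later times are controlled by the exit time. *)
Lemma sum_killed_walk_le (r : R) (T : nat) M x :
  (forall y, D y -> y.1%:~R ^+ 2 + y.2%:~R ^+ 2 <= r) -> D x -> (0 < T)%N ->
  \sum_(n < M) killed_walk n x x <=
    \sum_(k < T) central_bin_prob k ^+ 2 + central_bin_prob T ^+ 2 * (2 * r + 2).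
Proof.
move=> Dr Dx T0.
apply: (@le_trans _ _ (\sum_(n < T.*2 + M) killed_walk n x x)).
  rewrite addnC big_split_ord/= lerDl sumr_ge0// => i _; exact: killed_walk_ge0.
rewrite big_split_ord/= lerD//.
  apply: (@le_trans _ _ (\sum_(n < T.*2) walk2 n (0, 0))).
    apply: ler_sum => n _; apply: le_trans (killed_walk_le_walk2 _ _ _) _.
    by rewrite !subrr.
  clear T0; elim: T => [|T IH]; first by rewrite !big_ord0.
  rewrite doubleS !big_ord_recr/= -addrA lerD//.
  have W n : walk2 n (0, 0) = walk1 n 0 * walk1 n 0 by [].
  rewrite !W (@walk1_odd0 T.*2.+1) ?mul0r ?addr0/= ?odd_double//.
  by rewrite expr2 ler_pM ?walk1_ge0 ?walk1_even_le.
apply: (@le_trans _ _ (\sum_(m < M) central_bin_prob T ^+ 2 * survival m x)).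
  by apply: ler_sum => i _; rewrite addnC; exact: killed_walk_even_le.
rewrite -mulr_sumr ler_wpM2l ?exprn_even_ge0//.
exact: sum_survival_le.
Qed.

(** For a domain in a ball of radius O(N), the choice T = N^2 makes the late times
contribute O(1) and the early ones (1/pi) log N^2 + O(1). *)
Lemma sum_killed_walk_log (A : R) N M x : (0 < N)%N ->
  (forall y, D y -> y.1%:~R ^+ 2 + y.2%:~R ^+ 2 <= A * N%:R ^+ 2) -> D x ->
  \sum_(n < M) killed_walk n x x <= 2 / pi * ln N%:R + (1 + 3 / pi + 2 * A / pi).
Proof.
move=> N0 DA Dx; have p0 := @pi_gt0 R.
have NN : (0 < N ^ 2)%N by rewrite expn_gt0 N0.
have N1 : 1 <= N%:R ^+ 2 :> R by rewrite exprn_ege1// ler1n.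
have A0 : 0 <= A.
  have /= := DA _ Dx; have := sqr_ge0 (x.1%:~R : R); have := sqr_ge0 (x.2%:~R : R); nra.
apply: le_trans (sum_killed_walk_le M DA Dx NN) _.
have H1 : \sum_(k < N ^ 2) central_bin_prob k ^+ 2 <= 1 + pi^-1 * (1 + 2 * ln N%:R) :> R.
  rewrite -(big_mkord predT (fun k => central_bin_prob k ^+ 2)) big_ltn//.
  rewrite {1}/central_bin_prob bin0 expr0 divr1 expr1n lerD2l.
  rewrite (_ : 2 * ln N%:R = ln (N ^ 2)%:R); last first.
    by rewrite natrX lnXn ?ltr0n// mulr_natl.
  apply: le_trans (ler_wpM2l _ (sum_inv_le_ln NN)); last by rewrite invr_ge0 ltW.
  rewrite mulr_sumr big_nat_cond [leRHS]big_nat_cond ler_sum// => k /andP[/andP[k0 _] _].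
  by rewrite -invfM central_bin_prob_sqr.
have H2 : central_bin_prob (N ^ 2) ^+ 2 * (2 * (A * N%:R ^+ 2) + 2) <= 2 / pi + 2 * A / pi :> R.
  apply: (@le_trans _ _ ((pi * N%:R ^+ 2)^-1 * (2 * (A * N%:R ^+ 2) + 2))).
    rewrite ler_wpM2r//; first by rewrite addr_ge0// !mulr_ge0.
    by rewrite -natrX central_bin_prob_sqr.
  rewrite mulrC ler_pdivrMr; last by rewrite mulr_gt0// (lt_le_trans ltr01).
  have -> : (2 / pi + 2 * A / pi) * (pi * N%:R ^+ 2) = 2 * N%:R ^+ 2 + 2 * (A * N%:R ^+ 2) :> R.
    by rewrite -mulrDl [LHS]mulrA divfK ?gt_eqF//; ring.
  lra.
apply: le_trans (lerD H1 H2) _; rewrite le_eqVlt; apply/orP; left; apply/eqP.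
by move: (pi^-1) (ln _) => q l; ring.
Qed.

End killed_walk.

(** * The Green function of the continuous-time walk *)

Lemma neighboursE (x y : Z2) : neighbours x y <->
  y \in [:: (x.1 + 1, x.2); (x.1 - 1, x.2); (x.1, x.2 + 1); (x.1, x.2 - 1)].
Proof.
case: x y => a b [c e]; rewrite /neighbours !inE !xpair_eqE /=; split; lia.
Qed.

(** Re-routing edges to the collapsed vertex preserves the degree. *)
Lemma degree_inside (D : set Z2) (x : Z2) : D x -> degree D (Some x) = 4.
Proof.
move=> Dx.
pose s := [:: (x.1 + 1, x.2); (x.1 - 1, x.2); (x.1, x.2 + 1); (x.1, x.2 - 1)].
have us : uniq s by case: x @s {Dx} => a b; rewrite /= !inE !xpair_eqE /=; lia.
have uS : uniq (None :: map Some s).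
  by rewrite cons_uniq map_inj_uniq ?us ?andbT; [apply/mapP => -[]|move=> ? ? []].
rewrite /degree (fsbigE (None :: map Some s))//; last first.
  move=> [v|] _; last by rewrite inE.
  rewrite in_cons mem_map/=; last by move=> ? ? [].
  move=> vs; rewrite /edges; case: asboolP => // -[_ _ /neighboursE].
  by rewrite -/s (negbTE vs).
rewrite (eq_bigl xpredT) => [|v]; last by rewrite in_setT.
rewrite big_cons big_map.
have -> : edges D (Some x) None = count (fun z => z \notin D) s.
  rewrite /edges /ncard -size_filter; set r := [seq z <- s | z \notin D].
  have rE z : z \in r = (z \notin D) && (z \in s) by rewrite mem_filter.
  have -> : [set z | [/\ D x, ~ D z & neighbours x z]] = [set` [fset z in r]%fset].
    apply/seteqP; split=> z.
      by move=> [_ Dz /neighboursE zs]; rewrite /= in_fset/= rE zs andbT memNset.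
    rewrite /= in_fset/= rE => /andP[/negP zD zs]; split=> //.
      by move=> Dz; apply: zD; rewrite inE.
    exact/neighboursE.
  by rewrite set_fsetK card_fseq undup_id// filter_uniq.
have -> : (\sum_(y <- s) edges D (Some x) (Some y) = count (fun z => z \in D) s)%N.
  rewrite -sum1_count [RHS]big_mkcond/=; apply: eq_big_seq => z zs.
  rewrite /edges; case: asboolP => [[_ Dz _]|nD]; first by rewrite mem_set.
  by rewrite memNset// => Dz; apply: nD; split => //; exact/neighboursE.
apply: etrans (addnC _ _) _; exact: (count_predC (fun z => z \in D) s).
Qed.

Lemma integral_expR_tail (R : realType) (c u : R) : 0 < c ->
  (\int[lebesgue_measure]_(h in `[u, +oo[) (expR (- (c * h)))%:E =
    (expR (- (c * u)) / c)%:E)%E.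
Proof.
move=> c0.
pose F h : R := - (expR (- (c * h)) / c).
have dF (h : R) : is_derive h 1 F (expR (- (c * h))).
  have -> : F = (- c^-1) \*: (expR \o (fun h => - (c * h))).
    by apply/funext => y; rewrite /F/=; rewrite /GRing.scale/= mulNr mulrC.
  apply: is_derive_eq.
  by rewrite /GRing.scale/= !mulr1; field; rewrite gt_eqF.
have cE : continuous (fun h : R => expR (- (c * h))).
  move=> h; apply: (@continuous_comp _ _ _ (fun h : R => - (c * h)) expR).
    by apply: cvgN; apply: cvgM; [exact: cvg_cst|exact: cvg_id].
  exact: continuous_expR.
rewrite (@ge0_continuous_FTC2y _ _ F _ 0).
- by rewrite sub0e -EFinN opprK.
- by move=> x _; exact: expR_ge0.
- exact: continuous_subspaceT.
- rewrite -oppr0; apply: cvgN; rewrite -(mul0r c^-1); apply: cvgM; last exact: cvg_cst.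
  apply: (@cvg_comp _ _ _ (fun z => c * z) (fun z => expR (- z)) _ (pinfty_nbhs R)).
    exact: gt0_cvgMry.
  exact: cvgr_expR.
- by move=> x _; have := dF x; move=> /@ex_derive.
- apply: cvg_at_right_filter; apply: differentiable_continuous.
  by apply/derivable1_diffP; have := dF u; move=> /@ex_derive.
- by move=> x _; rewrite derive1E; have := dF x; move=> /@derive_val.
Qed.

Lemma measure_bigcup_le_sum (R : realType) d (T : measurableType d) (mu : {measure set T -> \bar R})
    (I : countType) (F : I -> set T) (s : seq I) :
  (forall i, measurable (F i)) -> (forall i, i \notin s -> mu (F i) = 0%E) ->
  (mu (\bigcup_i F i) <= \sum_(i <- s) mu (F i))%E.
Proof.
move=> mF F0.
pose N := \bigcup_n if choice.unpickle n is Some i then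
  if i \in s then set0 else F i else set0.
have mN : measurable N.
  by apply: bigcupT_measurable => n; case: choice.unpickle => // i; case: ifP.
have N0 : mu N = 0%E.
  apply/eqP; rewrite eq_le measure_ge0 andbT.
  apply: le_trans (measure_sigma_subadditive mu (F := fun n => if choice.unpickle n is Some i then
    if i \in s then set0 else F i else set0) _ mN _) _ => //.
    by move=> n; case: choice.unpickle => // i; case: ifP.
  rewrite eseries0// => n _ _; case: choice.unpickle => [i|]; last exact: measure0.
  by case: ifPn => [_|/F0//]; exact: measure0.
have mS (r : seq I) : measurable (\big[setU/set0]_(i <- r) F i).
  by apply: bigsetU_measurable.
have S1 (r : seq I) : (mu (\big[setU/set0]_(i <- r) F i) <= \sum_(i <- r) mu (F i))%E.
  elim: r => [|i r IH]; first by rewrite !big_nil measure0.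
  by rewrite !big_cons; apply: le_trans (measureU2 _ _ _) _ => //; rewrite leeD2l.
have sub : \bigcup_i F i `<=` \big[setU/set0]_(i <- s) F i `|` N.
  move=> t [i _ Fit]; have [si|si] := boolP (i \in s).
    by left; rewrite -bigcup_seq; exists i.
  by right; exists (choice.pickle i) => //; rewrite choice.pickleK (negbTE si).
apply: le_trans (S1 s); rewrite -[leRHS](measureU0 _ mN N0)//.
apply: le_measure => //; rewrite inE; last exact: measurableU.
by apply: countable_bigcupT_measurable.
Qed.

Section walk.
Context {R : realType}.

Lemma jump_probE (D : set Z2) (x y : Z2) :
  jump_prob D (Some x) (Some y) = `[< [/\ D x, D y & neighbours x y] >]%:R / 4 :> R.
Proof.
rewrite /jump_prob {1}/edges; case: asboolP => [[Dx Dy xy]|]; last by rewrite !mul0r.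
by rewrite degree_inside.
Qed.

Context (D : set Z2) d (Omega : measurableType d)
  (P : Z2 -> probability Omega R) (Y : nat -> Omega -> vertex)
  (W : nat -> {mfun Omega >-> R}).
Hypothesis mY : forall n v, measurable (Y n @^-1` [set v]).
Hypothesis W0 : forall n w, 0 < W n w.
Variable x : Z2.
Hypothesis lawYW : forall (n : nat) (y : nat -> vertex) (s : nat -> R),
  (forall i, 0 <= s i) ->
  P x [set w | forall i, (i <= n)%N -> Y i w = y i /\ s i < W i w] =
    ((y 0%N == Some x)%:R * (\prod_(0 <= i < n) jump_prob D (y i) (y i.+1)) *
      \prod_(0 <= i < n.+1) expR (- s i))%:E.

(** The walk follows y up to time k, avoids the collapsed vertex for j more steps,
ends at v and stays there for a time longer than s. *)
Let along k j (y : nat -> Z2) (v : Z2) (s : R) := [set w |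
  [/\ forall i, (i <= k)%N -> Y i w = Some (y i),
     forall i, (i <= k + j)%N -> Y i w <> None,
     Y (k + j) w = Some v & s < W (k + j) w]].

Let measurable_along k j y v s : measurable (along k j y v s).
Proof.
have -> : along k j y v s =
    (\bigcap_(i in `I_k.+1) (Y i @^-1` [set Some (y i)])) `&`
    (\bigcap_(i in `I_(k + j).+1) ~` (Y i @^-1` [set None])) `&`
    (Y (k + j) @^-1` [set Some v]) `&` (W (k + j) @^-1` `]s, +oo[).
  apply/seteqP; split=> w /=.
    move=> [h1 h2 h3 h4]; split; last by rewrite in_itv/= h4.
    by split; [split=> i; [exact: h1|exact: h2]|exact: h3].
  rewrite in_itv/= andbT => -[[[h1 h2] h3] h4]; split=> //.
apply: measurableI; last by rewrite -[X in measurable X]setTI; exact: measurable_funP.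
apply: measurableI; last exact: mY.
apply: measurableI; apply: bigcap_measurable; try by exists 0%N.
  by move=> i _; exact: mY.
by move=> i _; apply: measurableC; exact: mY.
Qed.

(** The law of the walk is given path by path; paths are merged from their end,
one step at a time, by summing over the position at time k + 1. *)
Let along_le j k y v s : 0 <= s ->
  (P x (along k j y v s) <= ((y 0%N == x)%:R *
    (\prod_(0 <= i < k) jump_prob D (Some (y i)) (Some (y i.+1))) *
    killed_walk D j (y k) v * expR (- s))%:E)%E.
Proof.
move=> s0; elim: j k y => [|j IH] k y.
  rewrite /=; have [<-|ykv] := eqVneq (y k) v; last first.
    rewrite [X in P x X](_ : _ = set0) ?measure0 ?mulr0 ?mul0r//.
    apply/seteqP; split=> // w [/= h1 _]; rewrite addn0 (h1 k)// => -[yk].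
    by rewrite yk eqxx in ykv.
  pose s' i : R := if i == k then s else 0.
  have := @lawYW k (fun i => Some (y i)) s'.
  have -> : \prod_(0 <= i < k.+1) expR (- s' i) = expR (- s).
    rewrite big_nat_recr//= /s' eqxx big_nat big1 ?mul1r// => i /andP[_ ik].
    by rewrite ltn_eqF// oppr0 expR0.
  rewrite mulr1 => <-; last by move=> i; rewrite /s'; case: ifP.
  apply: le_measure; rewrite ?inE; first exact: measurable_along.
    have -> : [set w | forall i, (i <= k)%N -> Y i w = Some (y i) /\ s' i < W i w] =
      \bigcap_(i in `I_k.+1) ((Y i @^-1` [set Some (y i)]) `&` (W i @^-1` `]s' i, +oo[)).
      by apply/seteqP; split=> w h i ik; have := h i ik; rewrite /= in_itv/= andbT.
    apply: bigcap_measurable; first by exists 0%N.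
    move=> i _; apply: measurableI; first exact: mY.
    by rewrite -[X in measurable X]setTI; exact: measurable_funP.
  move=> w [h1 _ _ h4] i ik; split; first exact: h1.
  by rewrite /s'; case: eqP => [->|_] //; rewrite addn0 in h4.
pose y' z i := if (i <= k)%N then y i else z.
have sub : along k j.+1 y v s `<=` \bigcup_z along k.+1 j (y' z) v s.
  move=> w [h1 h2]; rewrite addnS => h3 h4.
  have := h2 k.+1; rewrite addnS ltnS leq_addr => /(_ isT).
  case E : (Y k.+1 w) => [z|//] _; exists z => //; split.
  - move=> i; rewrite leq_eqVlt => /predU1P[->|ik]; first by rewrite /y' ltnn.
    by rewrite /y' -ltnS ik; exact: h1.
  - by move=> i ik; apply: h2; rewrite addnS.
  - by rewrite addSn.
  - by rewrite addSn.
pose nb := [:: ((y k).1 + 1, (y k).2); ((y k).1 - 1, (y k).2);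
  ((y k).1, (y k).2 + 1); ((y k).1, (y k).2 - 1)].
pose A := (y 0%N == x)%:R * (\prod_(0 <= i < k) jump_prob D (Some (y i)) (Some (y i.+1))) : R.
have A0 : 0 <= A.
  rewrite mulr_ge0// prodr_ge0// => i _; by rewrite jump_probE divr_ge0.
have H z : (P x (along k.+1 j (y' z) v s) <=
   (A * jump_prob D (Some (y k)) (Some z) * killed_walk D j z v * expR (- s))%:E)%E.
  apply: le_trans (IH _ _) _; rewrite lee_fin le_eqVlt; apply/orP; left; apply/eqP.
  have -> : y' z k.+1 = z by rewrite /y' ltnn.
  have -> : y' z 0%N = y 0%N by [].
  have y'k : y' z k = y k by rewrite /y' leqnn.
  have y'S : y' z k.+1 = z by rewrite /y' ltnn.
  rewrite big_nat_recr//= y'k y'S mulrA; congr (_ * _ * _ * _ * _).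
  by apply: eq_big_nat => i /andP[_ ik]; rewrite /y' ltnW// ik.
apply: (@le_trans _ _ (P x (\bigcup_z along k.+1 j (y' z) v s))).
  apply: le_measure; rewrite ?inE; [exact: measurable_along| |exact: sub].
  by apply: countable_bigcupT_measurable => // z; exact: measurable_along.
apply: le_trans (@measure_bigcup_le_sum _ _ _ (P x) _ _ nb _ _) _.
- by move=> z; exact: measurable_along.
- move=> z zn; apply/eqP; rewrite eq_le measure_ge0 andbT; apply: le_trans (H z) _.
  rewrite jump_probE; case: asboolP => [[_ _ /neighboursE]|_].
    by rewrite -/nb (negbTE zn).
  by rewrite !(mul0r, mulr0).
apply: (@le_trans _ _ (\sum_(z <- nb) (A * ((y k \in D)%:R / 4) * killed_walk D j z v * expR (- s))%:E)%E).
  apply: lee_sum => z _; apply: le_trans (H z) _; rewrite lee_fin.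
  rewrite ler_wpM2r ?expR_ge0// ler_wpM2r ?killed_walk_ge0// ler_wpM2l//.
  rewrite jump_probE ler_wpM2r//; case: asboolP => // -[Dk _ _].
  by rewrite mem_set.
rewrite sumEFin lee_fin /nb !big_cons big_nil -/A /= /walk_avg.
rewrite le_eqVlt; apply/orP; left; apply/eqP; by field.
Qed.

Let S n w := \sum_(0 <= k < n) W k w.
Let ends n v := [set w | (forall i, (i <= n)%N -> Y i w <> None) /\ Y n w = Some v].

Let measurable_ends n v : measurable (ends n v).
Proof.
have -> : ends n v = (\bigcap_(i in `I_n.+1) ~` (Y i @^-1` [set None])) `&`
    (Y n @^-1` [set Some v]).
  by apply/seteqP; split=> w /= [h1 h2]; split=> // i ik; apply: h1.
apply: measurableI; last exact: mY.
apply: bigcap_measurable; first by exists 0%N.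
by move=> i _; apply: measurableC; exact: mY.
Qed.

Let ends_le n v s : 0 <= s ->
  (P x (ends n v `&` [set w | (s < W n w)%R]) <= (killed_walk D n x v * expR (- s))%:E)%E.
Proof.
move=> s0.
have mE : measurable (ends n v `&` [set w | s < W n w]).
  apply: measurableI => //.
  have -> : [set w | s < W n w] = W n @^-1` `]s, +oo[.
    by apply/seteqP; split=> w /=; rewrite in_itv/= andbT.
  by rewrite -[X in measurable X]setTI; exact: measurable_funP.
have sub : ends n v `&` [set w | s < W n w] `<=` \bigcup_z along 0 n (fun=> z) v s.
  move=> w [[h1 h2] h3]; have := h1 0%N (leq0n _).
  case E : (Y 0%N w) => [z|//] _; exists z => //; split; rewrite ?add0n//.
  by move=> i; rewrite leqn0 => /eqP ->.
have H z : (P x (along 0 n (fun=> z) v s) <= ((z == x)%:R * killed_walk D n z v * expR (- s))%:E)%E.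
  by apply: le_trans (along_le _ _ _ _ s0) _; rewrite big_geq// mulr1.
apply: (@le_trans _ _ (P x (\bigcup_z along 0 n (fun=> z) v s))).
  apply: le_measure; rewrite ?inE//.
  by apply: countable_bigcupT_measurable => // z; exact: measurable_along.
apply: le_trans (@measure_bigcup_le_sum _ _ _ (P x) _ _ [:: x] _ _) _.
- by move=> z; exact: measurable_along.
- move=> z; rewrite inE => zx; apply/eqP; rewrite eq_le measure_ge0 andbT.
  by apply: le_trans (H z) _; rewrite (negbTE zx) !mul0r.
by rewrite big_seq1; apply: le_trans (H x) _; rewrite eqxx mul1r.
Qed.

Let strip (E : set Omega) (f g : Omega -> R) :=
  [set wt : Omega * R | E wt.1 /\ f wt.1 <= wt.2 < g wt.1].

Let measurable_strip E f g : measurable E -> measurable_fun setT f ->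
  measurable_fun setT g -> measurable (strip E f g).
Proof.
move=> mE mf mg.
have -> : strip E f g = (fst @^-1` E) `&`
    ((fun wt : Omega * R => wt.2 - f wt.1) @^-1` `[0, +oo[) `&`
    ((fun wt : Omega * R => g wt.1 - wt.2) @^-1` `]0, +oo[).
  apply/seteqP; split=> -[w t] /=; rewrite !in_itv/= !andbT subr_ge0 subr_gt0.
    by move=> [Ew /andP[]].
  by move=> [[Ew fw] gw]; split=> //=; rewrite fw gw.
apply: measurableI; [apply: measurableI|].
- by rewrite -[X in measurable X]setTI; exact: measurable_fst.
- rewrite -[X in measurable X]setTI; apply: measurable_funB => //.
  exact: measurableT_comp.
- rewrite -[X in measurable X]setTI; apply: measurable_funB => //.
  exact: measurableT_comp.
Qed.

(** The time spent at the n-th position is an interval starting at the n-th jump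
time; by Fubini only its length matters, so that it can be moved to 0. This
avoids the joint law of the jump times. *)
Let strip_shift E (f g : Omega -> R) : measurable E -> measurable_fun setT f ->
  measurable_fun setT g ->
  ((P x \x^ lebesgue_measure) (strip E f (f \+ g)%R) =
   (P x \x^ lebesgue_measure) (strip E (cst 0%R) g))%E.
Proof.
move=> mE mf mg.
have prodE X : measurable X -> ((P x \x lebesgue_measure) X = (P x \x^ lebesgue_measure) X)%E.
  by apply: product_measure_unique => A B mA mB; exact: product_measure2E.
rewrite -!prodE; [|exact: measurable_strip|]; last first.
  by apply: measurable_strip => //; exact: measurable_funD.
rewrite /product_measure1; apply: eq_integral => w _ /=.
have sE (f' g' : Omega -> R) : xsection (strip E f' g') w =
    if w \in E then [set` `[f' w, g' w[] else set0.
  apply/seteqP; split=> t; rewrite /xsection/= inE/= /strip/=.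
    by move=> [Ew]; rewrite mem_set// /= in_itv.
  case: ifPn => // wE; rewrite /= in_itv/=; split=> //.
  by rewrite inE in wE.
rewrite !sE; case: ifPn => // _.
by rewrite !lebesgue_measure_itv/= !lte_fin ltrDl; case: ifP => // _; rewrite -!EFinB subr0 addrAC subrr add0r.
Qed.

Variable X : R -> Omega -> vertex.
Hypothesis Soo : forall w, (S n w @[n --> \oo] --> +oo).
Hypothesis XY : forall n w t, S n w <= t < S n.+1 w -> X t w = Y n w.

Let S_mono w m n : (m <= n)%N -> S m w <= S n w.
Proof.
move=> mn; rewrite /S (@big_cat_nat _ _ _ m 0 n)//= lerDl sumr_ge0// => i _.
exact/ltW/W0.
Qed.

Let S_ge0 w n : 0 <= S n w.
Proof. by rewrite sumr_ge0// => i _; exact/ltW/W0. Qed.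

Let jump_index w t : 0 <= t ->
  exists2 n, S n w <= t < S n.+1 w & forall m, t < S m.+1 w -> (n <= m)%N.
Proof.
move=> t0.
have : exists n, t < S n w.
  have /cvgryPgt/(_ t)[n _ /(_ n (leqnn _))] := @Soo w; by exists n.
move=> /ex_minnP[[|n] tn nmin].
  by move: tn; rewrite /S big_geq// ltNge t0.
exists n => [|m tm]; last by rewrite -ltnS; exact: nmin.
by rewrite tn andbT leNgt; apply/negP => /nmin; rewrite ltnn.
Qed.

(** At time t the walk is at its n-th position for a unique n, and it has not been
killed iff none of its first n positions is the collapsed vertex. *)
Let alive t v : 0 <= t ->
  [set w | X t w = Some v /\ (t%:E < hitting_time X w)%E] =
  ysection (\bigcup_n strip (ends n v) (S n) (S n.+1)) t.
Proof.
move=> t0; rewrite ysection_bigcup; apply/seteqP; split=> w.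
  move=> [Xt tH]; have [n St _] := jump_index w t0.
  exists n => //; rewrite /ysection/= inE/=; split=> //; split; last by rewrite -(XY St).
  move=> i ii Yi; have /= : (hitting_time X w <= (S i w)%:E)%E.
    apply: ereal_inf_lbound; exists (S i w) => //; split; first exact: S_ge0.
    by rewrite (@XY i)// lexx/= /S big_nat_recr//= ltrDl.
  apply/negP; rewrite -ltNge; apply: le_lt_trans tH; rewrite lee_fin.
  by apply: le_trans (S_mono w ii) _; case/andP: St.
move=> [n _]; rewrite /ysection/= inE/= => -[[Yi Yn] St].
split; first by rewrite (XY St).
apply: (@lt_le_trans _ _ (S n.+1 w)%:E); first by rewrite lte_fin; case/andP: St.
apply: le_ereal_inf_tmp => _ [s [s0 Xs] <-]; rewrite lee_fin leNgt; apply/negP => sS.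
have [m Sm /(_ _ sS) mn] := jump_index w s0.
by apply: (Yi m mn); rewrite -(XY Sm).
Qed.

(** The holding times have mean 1, so the Green function of the continuous-time
walk is at most that of its sequence of positions. *)
Lemma integral_alive_le v :
  (\int[lebesgue_measure]_(t in `[0%R, +oo[)
     P x [set w | X t w = Some v /\ (t%:E < hitting_time X w)%E] <=
   \sum_(n <oo) (killed_walk D n x v)%:E)%E.
Proof.
have mS n : measurable_fun setT (S n) by apply: measurable_sum.
have mA n : measurable (strip (ends n v) (S n) (S n.+1)) by exact: measurable_strip.
have mU : measurable (\bigcup_n strip (ends n v) (S n) (S n.+1)).
  exact: bigcupT_measurable.
have -> : (\int[lebesgue_measure]_(t in `[0%R, +oo[)
     P x [set w | X t w = Some v /\ (t%:E < hitting_time X w)%E] =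
   (P x \x^ lebesgue_measure) (\bigcup_n strip (ends n v) (S n) (S n.+1)))%E.
  rewrite /product_measure2 integral_mkcond; apply: eq_integral => t _ /=.
  rewrite patchE mem_setE in_itv/= andbT; case: ifPn => [t0|]; first by rewrite alive.
  rewrite -ltNge => t0; rewrite ysection_bigcup bigcup0 ?measure0// => n _.
  apply/seteqP; split=> // w; rewrite /ysection/= inE/= => -[_ /andP[St _]].
  have := le_lt_trans St t0; rewrite ltNge => /negP; apply.
  exact: S_ge0.
apply: le_trans (measure_sigma_subadditive (P x \x^ lebesgue_measure)%E mA mU (@subset_refl _ _)) _.
apply: lee_nneseries => [n _ _|n _]; first exact: measure_ge0.
have -> : S n.+1 = S n \+ W n.
  by apply/funext => w; rewrite /S big_nat_recr.
apply: (@le_trans _ _ ((P x \x^ lebesgue_measure)%E (strip (ends n v) (cst 0) (W n)))).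
  by rewrite le_eqVlt; apply/orP; left; apply/eqP; exact: strip_shift.
rewrite /product_measure2.
apply: (@le_trans _ _ (\int[lebesgue_measure]_(t in `[0%R, +oo[)
    ((killed_walk D n x v)%:E * (expR (- (1 * t)))%:E)))%E; last first.
  rewrite ge0_integralZl//=.
  - by rewrite integral_expR_tail// mulr0 oppr0 expR0 divr1 mule1.
  - apply/measurable_EFinP/measurableT_comp => //; apply: measurable_funN.
    by apply: measurable_funM.
  - by rewrite lee_fin killed_walk_ge0.
rewrite [leRHS]integral_mkcond/=.
apply: ge0_le_integral => //.
- apply: (measurable_fun_ysection (P x)); exact: measurable_strip.
- apply/(measurable_restrictT _ _).1 => //.
  apply/measurable_EFinP/measurable_funM => //.
  apply: measurable_funTS; apply: measurableT_comp => //; apply: measurable_funN.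
  by apply: measurable_funM.
- move=> t _ /=; rewrite patchE mem_setE in_itv/= andbT; case: ifPn => [t0|].
    rewrite mul1r -EFinM; apply: le_trans (@ends_le n v t t0).
    rewrite le_eqVlt; apply/orP; left; apply/eqP; congr (P x _).
    apply/seteqP; split=> w; rewrite /ysection/= inE/=.
      by move=> [Ew /andP[]].
    by move=> [Ew tW]; split=> //=; rewrite t0.
  rewrite -ltNge => t0; rewrite [X in P x X](_ : _ = set0) ?measure0//.
  apply/seteqP; split=> // w; rewrite /ysection/= inE/= => -[_ /andP[]].
  by rewrite leNgt t0.
Qed.

End walk.

Lemma green_function_le (R : realType) (D : set Z2) (G : Z2 -> Z2 -> R) (x : Z2)
    (B : R) : green_function D G -> D x ->
  (forall M, \sum_(n < M) killed_walk D n x x <= B) -> G x x <= B / 4.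
Proof.
move=> [d [ Omega [P [X [[Y [W [mY W0 law XY]]] GE]]]]] Dx HB.
rewrite -lee_fin GE// mulrC EFinM lee_pmul2l//.
apply: le_trans (integral_alive_le mY (fun n w => (W0 w).1 n) (law x Dx) _ XY x) _.
  by move=> w; exact: (W0 w).2.
apply: lime_le; first by apply: is_cvg_nneseries => n _ _; rewrite lee_fin killed_walk_ge0.
by apply: nearW => M; rewrite sumEFin lee_fin big_mkord.
Qed.

(** The logarithm has the sharp constant and the error does not grow with N, so that
the density of the field near a_N will exceed K_N / N^2 by a bounded factor only. *)
Lemma green_function_diag_le (R : realType) (D : set Z2) (G : Z2 -> Z2 -> R) (x : Z2)
    (A : R) (N : nat) : green_function D G -> (0 < N)%N ->
  (forall y, D y -> y.1%:~R ^+ 2 + y.2%:~R ^+ 2 <= A * N%:R ^+ 2) -> D x ->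
  G x x <= gconst R * ln N%:R + (1 + 3 / pi + 2 * A / pi) / 4.
Proof.
move=> GD N0 DA Dx.
apply: le_trans (green_function_le GD Dx (fun M => sum_killed_walk_log M N0 DA Dx)) _.
rewrite mulrDl lerD2r le_eqVlt; apply/orP; left; apply/eqP.
by rewrite /gconst invfM; move: (pi^-1) => q; field.
Qed.

(** * Gaussian laws *)

Section gaussian.
Context {R : realType}.
Local Notation mu := (@lebesgue_measure R).

Lemma normal_pdf_peak_fun (m s x : R) : s != 0 ->
  normal_pdf m s x = normal_peak s * normal_fun m s x.
Proof. by move=> s0; rewrite normal_pdfE. Qed.

Lemma integral_normal_prob (m s : R) (f : R -> \bar R) : s != 0 ->
  measurable_fun setT f -> (\int[normal_prob m s]_x `|f x| < +oo)%E ->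
  (\int[normal_prob m s]_x f x = \int[mu]_x (f x * (normal_pdf m s x)%:E))%E.
Proof.
move=> s0 mf finf.
have dom := normal_prob_dominates m s.
rewrite -(Radon_Nikodym_change_of_variables dom)//=; last first.
  by apply/integrableP; split.
apply: ae_eq_integral => //.
- apply: emeasurable_funM => //; apply: (measurable_int mu).

- apply: emeasurable_funM => //=; apply/measurableT_comp => //=.
  exact: measurable_normal_pdf.
- apply: ae_eqe_mul2l => /=.
  rewrite Radon_NikodymE//=.
  case: cid => /= h [h1 h2 h3].
  apply: integral_ae_eq => //=.
  + by apply/measurableT_comp => //; exact: measurable_normal_pdf.
  + by move=> E E01 mE; rewrite -h3.
Qed.

(** The integrand times a Gaussian density is a multiple K of another Gaussian
density; the bound on K^2 follows from 1 + y <= exp y. *)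
Lemma normal_gauss_moment_le (m s a e : R) : s != 0 -> 0 < e ->
  exists2 K : R, 0 <= K /\ K ^+ 2 <= (1 + 2 * e * (s ^+ 2 + (m - a) ^+ 2))^-1 &
  (\int[normal_prob m s]_x (expR (- (e * (x - a) ^+ 2)))%:E = K%:E)%E.
Proof.
move=> s0 e0.
have s2 : 0 < s ^+ 2 by rewrite exprn_even_gt0.
pose q := 1 + 2 * e * s ^+ 2.
have q0 : 0 < q by rewrite /q addr_gt0// mulr_gt0// mulr_gt0.
pose s' := s / Num.sqrt q.
have s'0 : s' != 0 by rewrite mulf_neq0// invr_neq0// sqrtr_eq0 -ltNge.
have s'2 : s' ^+ 2 = s ^+ 2 / q by rewrite expr_div_n sqr_sqrtr// ltW.
pose m' := (m + 2 * e * s ^+ 2 * a) / q.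
pose r := normal_peak s / normal_peak s'.
pose K := r * expR (- (e * (m - a) ^+ 2 / q)).
have p0 := @pi_gt0 R.
have pk (z : R) : 0 <= z ^+ 2 * pi *+ 2.
  by rewrite mulrn_wge0// mulr_ge0 ?(ltW p0)// sqr_ge0.
have r2 : r ^+ 2 = q^-1.
  rewrite /r /normal_peak expr_div_n !exprVn !sqr_sqrtr//.
  rewrite s'2; move: (pi : R) p0 => p p0.
  rewrite invrK -mulr_natr -[X in _ * X]mulr_natr; field.
  by rewrite s0 !gt_eqF.
have K0 : 0 <= K.
  by rewrite !mulr_ge0 ?expR_ge0 ?invr_ge0 ?normal_peak_ge0.
exists K.
  split => //; set d := (m - a) ^+ 2.
  have d0 : 0 <= d by rewrite sqr_ge0.
  have e1 : 1 + 2 * e * (s ^+ 2 + d) = q * (1 + 2 * e * d / q).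
    by rewrite /q; field; rewrite -/q gt_eqF.
  have y0 : 0 < 1 + 2 * e * d / q by rewrite ltr_pwDl// divr_ge0 ?(ltW q0)// mulr_ge0// mulr_ge0// ltW.
  rewrite exprMn r2 -expRM_natl e1 invfM ler_wpM2l ?invr_ge0 ?(ltW q0)//.
  rewrite -[leRHS]div1r ler_pdivlMr//.
  rewrite -/d (_ : 2 * - (e * d / q) = - (2 * e * d / q)); last by ring.
  by rewrite expRN mulrC ler_pdivrMr ?expR_gt0// mul1r expR_ge1Dx.
have fE x : expR (- (e * (x - a) ^+ 2)) * normal_pdf m s x = K * normal_pdf m' s' x.
  have ee : expR (- (e * (x - a) ^+ 2)) * normal_fun m s x =
      expR (- (e * (m - a) ^+ 2 / q)) * normal_fun m' s' x.
    rewrite /normal_fun -!expRD; congr (expR _).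
    rewrite s'2 /m' /q -[X in _ / X]mulr_natr -[X in _ = _ + _ / X]mulr_natr; field.
    by rewrite s0/= gt_eqF.
  rewrite !normal_pdf_peak_fun// mulrCA ee /K /r.
  have := normal_peak_gt0 s'0; move: (normal_peak s') => B B0.
  by field; rewrite gt_eqF.
rewrite integral_normal_prob//.
- under eq_integral do rewrite -EFinM fE EFinM.
  rewrite integralZl//=; last exact: integrable_normal_pdf.
  by rewrite integral_normal_pdf mule1.
- apply/measurable_EFinP/measurableT_comp => //; apply: measurable_funN.
  apply: measurable_funM => //; apply: measurable_funX; exact: measurable_funB.
- under eq_integral => x _ do rewrite gee0_abs ?lee_fin ?expR_ge0//.
  apply: (@le_lt_trans _ _ (\int[normal_prob m s]_x cst 1 x)%E); last first.
      rewrite integral_cst//= mul1e.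
    by apply: le_lt_trans (probability_le1 (normal_prob m s) measurableT) _; rewrite ltry.
  apply: ge0_le_integral => //=.
  + apply/measurable_EFinP/measurableT_comp => //; apply: measurable_funN.
    by apply: measurable_funM => //; apply: measurable_funX; exact: measurable_funB.
  + by move=> x _; rewrite lee_fin -expR0 ler_expR oppr_le0 mulr_ge0 ?(ltW e0)// sqr_ge0.
Qed.

Lemma ge0_integral_normal_law d (Omega : measurableType d)
    (P : probability Omega R) (X : {RV P >-> R}) (m s : R) (f : R -> \bar R) :
  (forall A, measurable A -> P (X @^-1` A) = normal_law m s A) -> s != 0 ->
  measurable_fun setT f -> (forall x, 0 <= f x)%E ->
  (\int[P]_w f (X w) = \int[normal_prob m s]_x f x)%E.
Proof.
move=> law s0 mf f0.
pose X' : Omega -> measurableTypeR R := X.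
have mX' : measurable_fun setT X'.
  by move=> ? A mA; exact: (@measurable_funPT _ _ _ _ X measurableT A mA).
have := @ge0_integral_pushforward _ _ Omega (measurableTypeR R) R X' mX' P setT f.
rewrite preimage_setT => <- //.
by apply: eq_measure_integral => A mA _; rewrite [LHS]law// /normal_law (negbTE s0).
Qed.

(** Obtained from (1 - exp (- e u^2)) / e <= u^2 as e tends to 0, which only needs
the total mass of Gaussian densities. *)
Lemma normal_second_moment_ge d (Omega : measurableType d) (P : probability Omega R)
    (X : {RV P >-> R}) (m s a : R) :
  (forall A, measurable A -> P (X @^-1` A) = normal_law m s A) ->
  ((s ^+ 2 + (m - a) ^+ 2)%:E <= \int[P]_w ((X w - a) ^+ 2)%:E)%E.
Proof.
move=> law.
have msq : measurable_fun [set: R] (fun x : R => ((x - a) ^+ 2)%:E).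
  by apply/measurable_EFinP; apply: measurable_funX; exact: measurable_funB.
have [s0|s0] := eqVneq s 0.
  have -> : (\int[P]_w ((X w - a) ^+ 2)%:E = \int[distribution P X]_x ((x - a) ^+ 2)%:E)%E.
    by rewrite ge0_integral_distribution// => x; rewrite lee_fin sqr_ge0.
  rewrite (@eq_measure_integral _ _ _ _ (\d_m)); last first.
    by move=> A mA _; rewrite [LHS]law// /normal_law s0 eqxx.
  by rewrite integral_dirac// diracT mul1e s0 expr0n add0r.
rewrite (ge0_integral_normal_law (f := fun x => ((x - a) ^+ 2)%:E) law s0 msq); last first.
  by move=> x; rewrite lee_fin sqr_ge0.
set V := (X in (_ <= X)%E); set c := s ^+ 2 + _.
have c0 : 0 <= c by rewrite addr_ge0// sqr_ge0.
have VE (e : R) : 0 < e -> ((c / (1 + 2 * e * c))%:E <= V)%E.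
  move=> e0; have [K [K0 K2 KE]] := normal_gauss_moment_le m a s0 e0.
  have mexp : measurable_fun [set: R] (fun x : R => (expR (- (e * (x - a) ^+ 2)))%:E).
    apply/measurable_EFinP/measurableT_comp => //; apply: measurable_funN.
    by apply: measurable_funM => //; apply: measurable_funX; exact: measurable_funB.
  have : (1%:E <= K%:E + e%:E * V)%E.
    rewrite -KE /V -ge0_integralZl//; last 2 first.
      by move=> x _; rewrite lee_fin sqr_ge0.
      by rewrite lee_fin ltW.
    rewrite -ge0_integralD//; last 2 first.
      by move=> x _; rewrite mule_ge0// lee_fin ?sqr_ge0// ltW.
      exact: emeasurable_funM.
    have -> : (1%:E = \int[normal_prob m s]_x cst 1 x)%E.
      by rewrite integral_cst//= mul1e; apply/esym; exact: probability_setT.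
    apply: ge0_le_integral => //=.
    - by apply: emeasurable_funD => //; exact: emeasurable_funM.
    - move=> x _; rewrite -EFinM -EFinD lee_fin.
      by have := expR_ge1Dx (- (e * (x - a) ^+ 2)); lra.
  have : (0 <= V)%E by apply: integral_ge0 => x _; rewrite lee_fin sqr_ge0.
  case: V => [v|_ _|//]; last by rewrite leey.
  rewrite !lee_fin => v0 h.
  set q := 1 + 2 * e * c in K2 *.
  have q0 : 0 < q by rewrite /q ltr_pwDl// mulr_ge0// mulr_ge0// ltW.
  have : c / q * (2 * e) = 1 - q^-1 by rewrite /q; field; rewrite -/q gt_eqF.
  have K1 : K <= 1.
    have : K ^+ 2 <= 1 by apply: le_trans K2 _; rewrite invf_le1// /q lerDl mulr_ge0// mulr_ge0// ltW.
    by rewrite expr_le1.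
  move: (q^-1) K2 => r K2; move: (c * r) => z zE.
  rewrite -(ler_pM2r (_ : 0 < 2 * e)) ?mulr_gt0// zE; nra.
have : (0 <= V)%E by apply: integral_ge0 => x _; rewrite lee_fin sqr_ge0.
case: V VE => [v VE|_ _|//]; last by rewrite leey.
rewrite !lee_fin => v0.
apply/ler_addgt0Pr => e e0.
pose e' := e / (2 * v * c + 1).
have den0 : 0 < 2 * v * c + 1 by rewrite ltr_wpDl// !mulr_ge0.
have e'0 : 0 < e' by rewrite divr_gt0.
have := VE _ e'0; rewrite lee_fin ler_pdivrMr; last first.
  by rewrite ltr_pwDl// mulr_ge0// mulr_ge0// ltW.
move/le_trans; apply.
have : e' * (2 * v * c + 1) = e by rewrite divfK// gt_eqF.
nra.
Qed.

(** The bound s^2 + (m - a)^2 <= E (X - a)^2 = G + a^2 holds for every a: its part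
that is linear in a forces m = 0, and then a = 0 gives the variance. *)
Lemma centered_normal_law d (Omega : measurableType d) (P : probability Omega R)
    (X : {RV P >-> R}) (m s G : R) :
  (forall A, measurable A -> P (X @^-1` A) = normal_law m s A) ->
  'E_P[X]%E = 0%E -> covariance P X X = G%:E -> m = 0 /\ s ^+ 2 <= G.
Proof.
move=> law EX VX.
have mX : measurable_fun setT X by [].
have X2 : (\int[P]_w ((X w) ^+ 2)%:E = G%:E)%E.
  rewrite -VX unlock EX /= expectation.unlock; apply: eq_integral => w _.
  by rewrite !fctE /= subr0 expr2.
have iX2 : P.-integrable setT (fun w => ((X w) ^+ 2)%:E).
  apply/integrableP; split; first by apply/measurable_EFinP; exact: measurable_funX.
  by under eq_integral => w _ do rewrite gee0_abs ?lee_fin ?sqr_ge0//; rewrite X2 ltry.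
have iX : P.-integrable setT (EFin \o X).
  apply: (@le_integrable _ _ _ _ _ _ _ (fun w => (1 + (X w) ^+ 2)%:E)) => //.
  - exact/measurable_EFinP.
  - move=> w _ /=; rewrite lee_fin [leRHS]ger0_norm ?addr_ge0 ?sqr_ge0//.
    by rewrite ler_norml; apply/andP; split; have := sqr_ge0 (X w - 1); have := sqr_ge0 (X w + 1); nra.
  - under eq_fun do rewrite EFinD; apply: integrableD => //.
    exact: (finite_measure_integrable_cst P 1).
have H a : s ^+ 2 + (m - a) ^+ 2 <= G + a ^+ 2.
  rewrite -lee_fin; apply: le_trans (normal_second_moment_ge a law) _.
  have -> : (\int[P]_w ((X w - a) ^+ 2)%:E =
      \int[P]_w (((X w) ^+ 2)%:E + ((- 2 * a)%:E * (X w)%:E + (a ^+ 2)%:E)))%E.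
    by apply: eq_integral => w _; rewrite -EFinM -!EFinD; congr EFin; ring.
  rewrite integralD//; last first.
    apply: integrableD => //; first exact: integrableZl.
    exact: (finite_measure_integrable_cst P (a ^+ 2)).
  rewrite integralD//; last 2 first.
    exact: integrableZl.
    exact: (finite_measure_integrable_cst P (a ^+ 2)).
  rewrite integralZl// X2 integral_cst//= [P setT]probability_setT mule1.
  by move: EX; rewrite expectation.unlock => ->; rewrite mule0 add0e.
have m0 : m = 0.
  apply/eqP/negPn/negP => m0.
  have := H (- (G + 1) / (2 * m)).
  set b := - (G + 1) / (2 * m).
  have : 2 * m * b = - (G + 1) by rewrite /b mulrC divfK// mulf_neq0// .
  have := sqr_ge0 s; have := sqr_ge0 m; nra.
by split => //; have := H 0; rewrite m0 subrr expr0n addr0 addr0.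
Qed.

(** The Gaussian density at t increases with the standard deviation as long as the
latter is at most |t|; so an upper bound on the variance suffices. *)
Lemma normal_pdf_le (s V t : R) : s != 0 -> s ^+ 2 <= V -> V <= t ^+ 2 ->
  normal_pdf 0 s t <= (Num.sqrt (V * pi *+ 2))^-1 * expR (- (t ^+ 2 / (2 * V))).
Proof.
move=> s0 sV Vt; rewrite normal_pdf_peak_fun//.
have s2 : 0 < s ^+ 2 by rewrite exprn_even_gt0.
have V0 : 0 < V := lt_le_trans s2 sV.
have p0 := @pi_gt0 R.
have pk (z : R) : 0 < z -> 0 < z * pi *+ 2.
  by move=> z0; rewrite pmulrn_lgt0// mulr_gt0.
rewrite -ler_sqr ?nnegrE; last 2 first.
  by rewrite mulr_ge0 ?normal_peak_ge0// /normal_fun expR_ge0.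
  by rewrite mulr_ge0 ?invr_ge0 ?sqrtr_ge0 ?expR_ge0.
rewrite /normal_peak /normal_fun !exprMn !exprVn !sqr_sqrtr ?(ltW (pk _ s2)) ?(ltW (pk _ V0))// -!expRM_natl subr0.
have -> : 2 * (- t ^+ 2 / (s ^+ 2 *+ 2)) = - (t ^+ 2 / s ^+ 2).
  by rewrite -mulr_natr; field.
have -> : 2 * (- (t ^+ 2 / (2 * V))) = - (t ^+ 2 / V) by field; rewrite gt_eqF.
rewrite ler_pdivrMl ?pk// mulrA.
have -> : s ^+ 2 * pi *+ 2 * (V * pi *+ 2)^-1 = s ^+ 2 / V.
  move: (pi : R) p0 => p p0; rewrite -mulr_natr -[X in _ / X]mulr_natr; field.
  by rewrite !gt_eqF.
rewrite -[s ^+ 2 / V]invf_div ler_pdivlMl ?divr_gt0//.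
have -> : expR (- (t ^+ 2 / V)) =
    expR (t ^+ 2 / s ^+ 2 - t ^+ 2 / V) * expR (- (t ^+ 2 / s ^+ 2)).
  by rewrite -expRD; congr expR; ring.
rewrite ler_wpM2r ?expR_ge0//; apply: le_trans (expR_ge1Dx _).
have -> : 1 + (t ^+ 2 / s ^+ 2 - t ^+ 2 / V) = V / s ^+ 2 + (t ^+ 2 - V) * (V - s ^+ 2) / (V * s ^+ 2).
  by field; rewrite s0 gt_eqF.
by rewrite lerDl divr_ge0// mulr_ge0 ?subr_ge0// ltW.
Qed.

Lemma gconst_gt0 : 0 < gconst R.
Proof. by rewrite invr_gt0 mulr_gt0// pi_gt0. Qed.

Lemma near_ln_ge (A : R) : \forall N \near \oo, A <= ln N%:R.
Proof.
near=> N; rewrite -ler_expR lnK; last by rewrite posrE; near: N; exists 1%N => // n; rewrite ltr0n.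
near: N; exact: nbhs_infty_ger.
Unshelve. all: by end_near. Qed.

Lemma level_sequence_bounds (lambda : R) (a : nat -> R) : 0 < lambda < 1 ->
  level_sequence lambda a ->
  \forall N \near \oo, lambda * Num.sqrt (gconst R) * ln N%:R <= a N /\
    a N <= 2 * Num.sqrt (gconst R) * ln N%:R.
Proof.
move=> /andP[l0 l1] [a0 al].
have sg : 0 < Num.sqrt (gconst R) by rewrite sqrtr_gt0 gconst_gt0.
near=> N.
have L1 : 1 <= ln N%:R :> R by near: N; exact: near_ln_ge.
have D0 : 0 < 2 * Num.sqrt (gconst R) * ln N%:R :> R.
  by rewrite mulr_gt0 ?(lt_le_trans ltr01 L1)// mulr_gt0.
split.
  have : lambda / 2 <= a N / (2 * Num.sqrt (gconst R) * ln N%:R).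
    near: N; apply: (cvgr_ge lambda al); rewrite ltr_pdivrMr//; lra.
  by rewrite ler_pdivlMr//; apply: le_trans; rewrite le_eqVlt; apply/orP; left; apply/eqP; field.
have : a N / (2 * Num.sqrt (gconst R) * ln N%:R) <= 1.
  by near: N; apply: (cvgr_le lambda al).
by rewrite ler_pdivrMr// mul1r.
Unshelve. all: by end_near. Qed.

(** The density at a_N is comparable with K_N / N^2: the variance exceeds
g log N by C0 at most, which changes a_N^2 / (2 g log N) by O(1) because a_N is of
order log N. The cross term a_N y / (g log N) gives the decay in y. *)
Lemma thick_density_le (lambda : R) (a : nat -> R) (C0 : R) : 0 < lambda < 1 ->
  level_sequence lambda a -> 0 <= C0 ->
  exists c C : R, [/\ 0 < c, 0 < C &
    \forall N \near \oo, 1 < a N /\ forall s y : R, s != 0 ->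
      s ^+ 2 <= gconst R * ln N%:R + C0 -> -1 <= y ->
      normal_pdf 0 s (a N + y) <= C * (KN a N / N%:R ^+ 2) * expR (- (c * y))].
Proof.
move=> l01 la C00; have := l01 => /andP[l0 l1].
set g := gconst R; set sg := Num.sqrt g.
have g0 : 0 < g := gconst_gt0.
have sg0 : 0 < sg by rewrite sqrtr_gt0.
have sg2 : sg ^+ 2 = g by rewrite sqr_sqrtr// ltW.
pose c := lambda / (2 * sg).
exists c, (expR (2 * C0 / g + 2 / sg)); split; first by rewrite divr_gt0// mulr_gt0.
  exact: expR_gt0.
have bounds := level_sequence_bounds l01 la.
near=> N.
have [] : lambda * sg * ln N%:R <= a N /\ a N <= 2 * sg * ln N%:R by near: N.
have L1 : 1 <= ln N%:R :> R by near: N; exact: near_ln_ge.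
have L2 : C0 / g <= ln N%:R :> R by near: N; exact: near_ln_ge.
have L3 : 3 / (lambda * sg) <= ln N%:R :> R by near: N; exact: near_ln_ge.
have L4 : 8 / lambda ^+ 2 <= ln N%:R :> R by near: N; exact: near_ln_ge.
have N0 : (0 < N)%N by near: N; exists 1%N.
rewrite /KN -/g; set L := ln N%:R in L1 L2 L3 L4 *; move: (a N) => t tl tu.
have L0 : 0 < L := lt_le_trans ltr01 L1.
rewrite ler_pdivrMr// in L2; rewrite ler_pdivrMr ?mulr_gt0// in L3.
rewrite ler_pdivrMr ?exprn_gt0// in L4.
have t3 : 3 <= t by apply: le_trans tl; rewrite mulrC.
split; first by apply: lt_le_trans t3; lra.
move=> s y s0 sV y1; set V := g * L + C0 in sV.
have gL : 0 < g * L by rewrite mulr_gt0.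
have VgL : g * L <= V by rewrite lerDl.
have V0 : 0 < V := lt_le_trans gL VgL.
have V2 : V <= 2 * (g * L) by rewrite /V; lra.
have tt : lambda * sg * L / 2 <= t + y.
  apply: (@le_trans _ _ (t - 1)); lra.
have Vt : V <= (t + y) ^+ 2.
  apply: (@le_trans _ _ ((lambda * sg * L / 2) ^+ 2)); last first.
    by rewrite ler_sqr// nnegrE ?(le_trans _ tt)// divr_ge0// !mulr_ge0// ltW.
  apply: le_trans V2 _.
  have -> : (lambda * sg * L / 2) ^+ 2 = (g * L) * (L * lambda ^+ 2) / 4.
    by rewrite -sg2; field.
  rewrite ler_pdivlMr//; nra.
apply: le_trans (normal_pdf_le s0 sV Vt) _.
(* Here 2 pi g = 1. *)
have peak : (Num.sqrt (V * pi *+ 2))^-1 <= (Num.sqrt L)^-1.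
  rewrite lef_pV2 ?posrE ?sqrtr_gt0//; last by rewrite pmulrn_lgt0// mulr_gt0// pi_gt0.
  apply: ler_wsqrtr; rewrite -mulrnAr.
  apply: (@le_trans _ _ (g * L * (pi *+ 2))); last by rewrite ler_wpM2r// mulrn_wge0// pi_ge0.
  have gp : g * (2 * pi) = 1 by rewrite mulVf// mulf_neq0// gt_eqF// pi_gt0.
  by rewrite -[pi *+ 2]mulr_natl mulrAC gp mul1r.
have -> : N%:R ^+ 2 / Num.sqrt L * expR (- (t ^+ 2 / (2 * g * L))) / N%:R ^+ 2 =
   (Num.sqrt L)^-1 * expR (- (t ^+ 2 / (2 * g * L))).
  by field; rewrite !gt_eqF ?sqrtr_gt0// ltr0n.
rewrite [X in _ <= X * _]mulrCA -[leRHS]mulrA; apply: ler_pM => //; rewrite ?invr_ge0 ?sqrtr_ge0 ?expR_ge0//.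
rewrite -!expRD ler_expR.
have H1 : t ^+ 2 / (2 * g * L) - t ^+ 2 / (2 * V) <= 2 * C0 / g.
  have -> : t ^+ 2 / (2 * g * L) - t ^+ 2 / (2 * V) = t ^+ 2 * C0 / (2 * (g * L) * V).
    by rewrite /V; field; rewrite -/V !gt_eqF.
  rewrite ler_pdivrMr ?mulr_gt0//.
  have -> : 2 * C0 / g * (2 * (g * L) * V) = 4 * L * V * C0 by field; rewrite gt_eqF.
  rewrite ler_wpM2r//; apply: (@le_trans _ _ ((2 * sg * L) ^+ 2)).
    by rewrite ler_sqr// nnegrE; lra.
  have -> : (2 * sg * L) ^+ 2 = 4 * L * (g * L) by rewrite -sg2; ring.
  by rewrite ler_wpM2l// mulr_ge0// ltW.
have H2 : c <= t / V.
  rewrite ler_pdivlMr//; apply: (@le_trans _ _ (c * (2 * (g * L)))).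
    by rewrite ler_wpM2l// divr_ge0 ?mulr_ge0 ?(ltW l0)// ltW.
  apply: le_trans tl; rewrite le_eqVlt; apply/orP; left; apply/eqP.
  by rewrite /c -sg2; field; rewrite gt_eqF.
have H3 : t / V <= 2 / sg.
  rewrite ler_pdivrMr//; apply: (@le_trans _ _ (2 / sg * (g * L))); last first.
    by rewrite ler_wpM2l// divr_ge0// ltW.
  apply: le_trans tu _; rewrite le_eqVlt; apply/orP; left; apply/eqP.
  by rewrite -sg2; field; rewrite gt_eqF.
have c0 : 0 < c by rewrite divr_gt0// mulr_gt0.
have H4 : - (t / V * y) <= 2 / sg - c * y.
  move: (t / V) (2 / sg) H2 H3 => A B H2 H3.
  by have [y0|y0] := leP 0 y; nra.
have H5 : t ^+ 2 / (2 * V) + t / V * y <= (t + y) ^+ 2 / (2 * V).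
  have -> : (t + y) ^+ 2 / (2 * V) = t ^+ 2 / (2 * V) + t / V * y + y ^+ 2 / (2 * V).
    by field; rewrite gt_eqF.
  by rewrite lerDl divr_ge0 ?sqr_ge0// mulr_ge0// ltW.
lra.
Unshelve. all: by end_near. Qed.

Section tails.
Context d (Omega : measurableType d) (P : probability Omega R) (X : {RV P >-> R}).
Variables (s t M c : R).
Hypothesis law : forall A, measurable A -> P (X @^-1` A) = normal_law 0 s A.
Hypotheses (t1 : 1 < t) (M0 : 0 <= M) (c0 : 0 < c).
Hypothesis density : s != 0 -> forall y, -1 <= y ->
  normal_pdf 0 s (t + y) <= M * expR (- (c * y)).

Lemma normal_upper_tail (u : R) : -1 <= u ->
  (P (X @^-1` `[(t + u)%R, +oo[) <= (M * (expR (- (c * u)) / c))%:E)%E.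
Proof.
move=> u1; rewrite law; last exact: measurable_itv.
rewrite /normal_law; case: ifPn => [_|s0].
  rewrite diracE memNset ?lee_fin ?mulr_ge0 ?invr_ge0 ?expR_ge0 ?(ltW c0)//.
  have tu : 0 < t + u by rewrite -(subrr 1) ltr_leD.
  by rewrite /= in_itv/= andbT leNgt tu.
apply: (@le_trans _ _ (\int[lebesgue_measure]_(x in `[(t + u)%R, +oo[)
    ((M * expR (c * t))%:E * (expR (- (c * x)))%:E))%E).
  rewrite /normal_prob; apply: ge0_le_integral => //=.
  - by move=> x _; rewrite lee_fin normal_pdf_ge0.
  - apply/measurable_funTS/measurable_EFinP; exact: measurable_normal_pdf.
  - apply/measurable_funTS/measurable_EFinP; apply: measurable_funM => //.
    by apply: measurableT_comp => //; apply: measurable_funN; apply: measurable_funM.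
  - move=> x; rewrite in_itv/= andbT => tx; rewrite -EFinM lee_fin -mulrA -expRD.
    have := density s0 (y := x - t); rewrite subrKC => /(_ _)/le_trans; apply; first lra.
    by rewrite mulrBr opprB.
rewrite ge0_integralZl//=.
- rewrite integral_expR_tail// -EFinM lee_fin -!mulrA ler_wpM2l// !mulrA -expRD.
  by rewrite ler_wpM2r ?invr_ge0 ?(ltW c0)// ler_expR; lra.
- apply/measurable_funTS/measurable_EFinP.
  by apply: measurableT_comp => //; apply: measurable_funN; apply: measurable_funM.
- by rewrite lee_fin mulr_ge0 ?expR_ge0.
Qed.

Lemma normal_below (e : R) : 0 < e <= 1 ->
  (P (X @^-1` `[(t - e)%R, t[) <= (M * expR c * e)%:E)%E.
Proof.
move=> /andP[e0 e1]; rewrite law; last exact: measurable_itv.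
rewrite /normal_law; case: ifPn => [_|s0].
  rewrite diracE memNset ?lee_fin ?mulr_ge0 ?expR_ge0 ?(ltW e0)//.
  have te : 0 < t - e by rewrite subr_gt0 (le_lt_trans e1).
  by rewrite /= in_itv/= leNgt te.
apply: (@le_trans _ _ (\int[lebesgue_measure]_(x in `[(t - e)%R, t[) (M * expR c)%:E)%E).
  rewrite /normal_prob; apply: ge0_le_integral => //=.
  - by move=> x _; rewrite lee_fin normal_pdf_ge0.
  - apply/measurable_funTS/measurable_EFinP; exact: measurable_normal_pdf.
  - move=> x; rewrite in_itv/= => /andP[tx xt]; rewrite lee_fin.
    have := density s0 (y := x - t); rewrite subrKC => /(_ _)/le_trans; apply; first lra.
    rewrite ler_wpM2l// ler_expR -mulrN opprB -[leRHS]mulr1.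
    rewrite ler_wpM2l ?(ltW c0)// lerBlDr (le_trans _ (lerD e1 tx))//.
    by rewrite addrC subrK.
rewrite integral_cst//= lebesgue_measure_itv/= lte_fin ltrBlDr ltrDl e0.
by rewrite -EFinB -EFinM lee_fin opprB addrCA subrr addr0.
Qed.

End tails.
End gaussian.

(** * Convergence in law through approximation in mean *)

Section comparison.
Context {R : realType}.

(** F is only continuous and bounded: uniform continuity on [-T, T] handles the
close pairs, and the trivial bound 2B is charged to |x - y| >= rho or |x| > T. *)
Lemma continuous_modulus (F : R -> R) (B T delta : R) : continuous F ->
  (forall x, `|F x| <= B) -> 0 < T -> 0 < delta ->
  exists2 rho, 0 < rho & forall x y,
    `|F x - F y| <= delta + rho^-1 * (2 * B) * `|x - y| + T^-1 * (2 * B) * `|x|.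
Proof.
move=> cF FB T0 d0.
have B0 : 0 <= B := le_trans (normr_ge0 _) (FB 0).
have FF x y : `|F x - F y| <= 2 * B.
  by rewrite (le_trans (ler_normB _ _))// mulr_natl mulr2n lerD.
have [rho rho0 H] : exists2 rho : R, 0 < rho &
    forall x, `[- T, T]%classic x -> forall y, `|x - y| < rho -> `|F x - F y| <= delta.
  have /compact_near_coveringP cov := @segment_compact R (- T) T.
  have /cov : forall x, `[- T, T]%classic x -> \forall x' \near x & rho \near (0 : R)^'+,
      forall y, `|x' - y| < rho -> `|F x' - F y| <= delta.
    move=> x _.
    have /cvgrPdist_le/(_ (delta / 2)) := cF x.
    rewrite divr_gt0// => /(_ isT) /nbhs_ballP[r /= r0 Hr].
    exists (ball x (r / 2), [set rho | rho < r / 2]) => /=.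
      split; first by apply: nbhsx_ballx; rewrite divr_gt0.
      by apply: nbhs_right_lt; rewrite divr_gt0.
    move=> [x' rho] /= [xx' rhor] y xy.
    have h1 : `|F x - F x'| <= delta / 2.
      apply: Hr; apply: le_ball xx'; lra.
    have h2 : `|F x - F y| <= delta / 2.
      apply: Hr; rewrite /ball /= in xx' *.
      rewrite (_ : x - y = (x - x') + (x' - y)); last by rewrite addrA subrK.
      by rewrite (le_lt_trans (ler_normD _ _))//; lra.
    rewrite (_ : F x' - F y = - (F x - F x') + (F x - F y)); last by rewrite opprB addrA subrK.
    by rewrite (le_trans (ler_normD _ _))// normrN; lra.
  move=> Hn; have /filter_ex[rho [rho0 H]] : \forall rho \near (0 : R)^'+, 0 < rho /\
      `[- T, T]%classic `<=` (fun x => forall y, `|x - y| < rho -> `|F x - F y| <= delta).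
    by apply: filterI; [exact: nbhs_right_gt|exact: Hn].
  by exists rho => // x /H.
exists rho => // x y.
have t1 : 0 <= rho^-1 * (2 * B) * `|x - y| by rewrite !mulr_ge0// invr_ge0 ltW.
have t2 : 0 <= T^-1 * (2 * B) * `|x| by rewrite !mulr_ge0// invr_ge0 ltW.
have [xT|xT] := leP `|x| T; last first.
  apply: (le_trans (FF x y)).
  have : 2 * B <= T^-1 * (2 * B) * `|x|.
    rewrite mulrAC ler_peMl ?mulr_ge0// mulrC ler_pdivlMr// mul1r; exact: ltW.
  lra.
have [xy|xy] := ltP `|x - y| rho.
  have : `|F x - F y| <= delta by apply: H => //; rewrite /= in_itv/= -ler_norml.
  lra.
apply: (le_trans (FF x y)).
have : 2 * B <= rho^-1 * (2 * B) * `|x - y|.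
  by rewrite mulrAC ler_peMl ?mulr_ge0// mulrC ler_pdivlMr// mul1r.
lra.
Qed.

Lemma bounded_expectation d (Omega : measurableType d) (P : probability Omega R)
    (f : Omega -> R) (B : R) : measurable_fun setT f -> (forall w, `|f w| <= B) ->
  P.-integrable setT (EFin \o f).
Proof.
move=> mf fB; apply: measurable_bounded_integrable => //.
  by rewrite [X in (X < _)%E]probability_setT ltry.
exists B; split; first exact: num_real.
by move=> x Bx w _; exact: le_trans (fB w) (ltW Bx).
Qed.

Lemma expectation_compare (F : R -> R) (B A delta : R) : continuous F ->
  (forall x, `|F x| <= B) -> 0 < A -> 0 < delta ->
  exists2 M : R, 0 <= M &
  forall d (Omega : measurableType d) (P : probability Omega R) (X Y : Omega -> R) (eta : R),
    measurable_fun setT X -> measurable_fun setT Y ->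
    (\int[P]_w `|X w|%:E <= A%:E)%E -> (\int[P]_w `|X w - Y w|%:E <= eta%:E)%E ->
  `|fine ('E_P[F \o X]) - fine ('E_P[F \o Y])| <= delta + M * eta.
Proof.
move=> cF FB A0 d0.
have B0 : 0 <= B := le_trans (normr_ge0 _) (FB 0).
pose T := 2 * (2 * B + 1) * A / delta.
have T0 : 0 < T by rewrite divr_gt0// !mulr_gt0// ltr_wpDl// mulr_ge0.
have [|rho rho0 H] := continuous_modulus cF FB T0 (_ : 0 < delta / 2).
  by rewrite divr_gt0.
exists (rho^-1 * (2 * B)); first by rewrite !mulr_ge0// invr_ge0 ltW.
move=> d Omega P X Y eta mX mY XA XY.
have mF : measurable_fun setT F by exact: continuous_measurable_fun.
have mFX : measurable_fun setT (F \o X) by exact: measurableT_comp.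
have mFY : measurable_fun setT (F \o Y) by exact: measurableT_comp.
have iX := bounded_expectation P mFX (fun w => FB (X w)).
have iY := bounded_expectation P mFY (fun w => FB (Y w)).
rewrite -lee_fin expectation.unlock.
have fX : (\int[P]_w ((F \o X) w)%:E)%E \is a fin_num by exact: integrable_fin_num.
have fY : (\int[P]_w ((F \o Y) w)%:E)%E \is a fin_num by exact: integrable_fin_num.
have <- : (`|\int[P]_w ((F \o X) w)%:E - \int[P]_w ((F \o Y) w)%:E| =
    `|fine (\int[P]_w ((F \o X) w)%:E) - fine (\int[P]_w ((F \o Y) w)%:E)|%:E)%E.
  by rewrite -[in LHS](fineK fX) -[in LHS](fineK fY) -EFinB abse_EFin.
rewrite -integralB//=.
apply: le_trans (le_abse_integral _ _ _) _ => //.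
  by apply/measurable_EFinP; exact: measurable_funB.
apply: (@le_trans _ _ (\int[P]_w ((delta / 2)%:E + (rho^-1 * (2 * B))%:E * `|X w - Y w|%:E
   + (T^-1 * (2 * B))%:E * `|X w|%:E))%E).
  apply: ge0_le_integral => //=.
  - by apply/measurable_EFinP; apply: measurableT_comp => //; exact: measurable_funB.
  - apply: emeasurable_funD; [apply: emeasurable_funD|] => //.
      apply: emeasurable_funM => //; apply/measurable_EFinP; apply: measurableT_comp => //.
      exact: measurable_funB.
    by apply: emeasurable_funM => //; apply/measurable_EFinP; exact: measurableT_comp.
  - by move=> w _; rewrite -!EFinM -!EFinD lee_fin.
have c1 : 0 <= rho^-1 * (2 * B) by rewrite !mulr_ge0// invr_ge0 ltW.
have c2 : 0 <= T^-1 * (2 * B) by rewrite !mulr_ge0// invr_ge0 ltW.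
have m1 : measurable_fun setT (fun w => `|X w - Y w|%:E).
  by apply/measurable_EFinP; apply: measurableT_comp => //; exact: measurable_funB.
have m2 : measurable_fun setT (fun w => `|X w|%:E).
  by apply/measurable_EFinP; exact: measurableT_comp.
have d2 : 0 <= delta / 2 by rewrite divr_ge0// ltW.
rewrite ge0_integralD//; last 4 first.
- by move=> w _; rewrite -EFinM -EFinD lee_fin addr_ge0// mulr_ge0.
- by apply: emeasurable_funD => //; exact: emeasurable_funM.
- by move=> w _; rewrite -EFinM lee_fin mulr_ge0.
- exact: emeasurable_funM.
rewrite ge0_integralD//; last 2 first.
- by move=> w _; rewrite -EFinM lee_fin mulr_ge0.
- exact: emeasurable_funM.
rewrite integral_cst//= [P setT]probability_setT mule1 !ge0_integralZl//.
have -> : delta + rho^-1 * (2 * B) * eta = delta / 2 + rho^-1 * (2 * B) * eta + delta / 2.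
  by rewrite addrAC -splitr.
rewrite !EFinD; apply: leeD; first (apply: leeD => //).
  by rewrite [leRHS]EFinM; apply: lee_wpmul2l.
apply: (@le_trans _ _ ((T^-1 * (2 * B))%:E * A%:E)%E).
  by apply: lee_wpmul2l.
rewrite -EFinM lee_fin -mulrA ler_pdivrMl//.
have -> : T * (delta / 2) = (2 * B + 1) * A by rewrite /T; field; rewrite gt_eqF.
by rewrite ler_wpM2r ?(ltW A0)// lerDl.
Qed.

(** If X_N is close in mean to Y_k,N uniformly in N, the limits N -> oo of the Y_k,N
pass to X_N; the bound on the mean of |X_N| is the tightness that allows test
functions which are not uniformly continuous. *)
Lemma cvg_in_law_approx (d : nat -> measure_display)
    (Omega : forall N, measurableType (d N)) (P : forall N, probability (Omega N) R)
    (X : forall N, Omega N -> R) (Y : forall (k N : nat), Omega N -> R)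
    d' (Omega' : measurableType d') (P' : probability Omega' R)
    (Xlim : Omega' -> R) (Ylim : nat -> Omega' -> R) (A : R) (eta : nat -> R) :
  (forall N, (0 < N)%N -> measurable_fun setT (X N)) ->
  (forall k N, (0 < N)%N -> measurable_fun setT (Y k N)) ->
  measurable_fun setT Xlim -> (forall k, measurable_fun setT (Ylim k)) ->
  (forall w, Ylim k w @[k --> \oo] --> Xlim w) ->
  (forall F : R -> R, continuous F -> (exists B, forall x, `|F x| <= B) ->
    forall k, ('E_(P N)[F \o @Y k N] @[N --> \oo] --> 'E_P'[F \o Ylim k])%E) ->
  0 < A -> (\forall N \near \oo, (\int[P N]_w `|X N w|%:E <= A%:E)%E /\
    forall k, (\int[P N]_w `|X N w - Y k N w|%:E <= (eta k)%:E)%E) ->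
  eta @ \oo --> 0 ->
  cvg_in_law [set: R] P X P' Xlim.
Proof.
move=> mX mY mXl mYl YX Ycvg A0 near_eta eta0 F cF0 [B FB'].
have cF : continuous F := (continuous_subspace_setT F).2 cF0.
have FB x : `|F x| <= B by exact: FB'.
have mF : measurable_fun setT F by exact: continuous_measurable_fun.
have fin d0 (O : measurableType d0) (Q : probability O R) (f : O -> R) :
    measurable_fun setT f -> ('E_Q[F \o f])%E \is a fin_num.
  move=> mf; rewrite expectation.unlock; apply: integrable_fin_num => //.
  have mFf : measurable_fun setT (F \o f) by exact: measurableT_comp.
  exact: (bounded_expectation Q mFf (fun w => FB (f w))).
have limE : fine ('E_P'[F \o Ylim k])%E @[k --> \oo] --> fine ('E_P'[F \o Xlim])%E.
  apply: fine_cvg; rewrite fineK ?fin//; rewrite expectation.unlock.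
  have [||||//|_ _] := @dominated_convergence _ _ _ P' setT measurableT
      (fun k w => (F (Ylim k w))%:E) (fun w => (F (Xlim w))%:E) (cst B%:E).
  - by move=> k; apply/measurable_EFinP; exact: measurableT_comp.
  - by apply/measurable_EFinP; exact: measurableT_comp.
  - apply: aeW => w _; apply: cvg_EFin; first by apply: nearW.
    by apply: continuous_cvg; [exact: cF|exact: YX].
  - exact: (finite_measure_integrable_cst P' B).
  - by apply: aeW => w k _; rewrite lee_fin.
  - by apply.
rewrite -[X in _ --> X]fineK ?fin//; apply: cvg_EFin.
  by exists 1%N => // N N0; rewrite fin//; exact: mX.
apply/cvgrPdist_le => e e0.
have [|M M0 HM] := expectation_compare cF FB A0 (_ : 0 < e / 4); first by rewrite divr_gt0.
have : \forall k \near \oo, M * eta k <= e / 4 /\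
    `|fine ('E_P'[F \o Xlim])%E - fine ('E_P'[F \o Ylim k])%E| <= e / 4.
  apply: filterI; last by move/cvgrPdist_le : limE; apply; rewrite divr_gt0.
  have : M * eta k @[k --> \oo] --> M * 0 by apply: cvgM => //; exact: cvg_cst.
  rewrite mulr0 => /cvgr_le; apply; rewrite divr_gt0//.
move=> /filter_ex[k [k1 k2]].
have /fine_cvg/cvgrPdist_le/(_ (e / 4)) : ('E_(P N)[F \o Y k N] @[N --> \oo] -->
    (fine 'E_P'[F \o Ylim k])%:E)%E.
  by rewrite fineK ?fin//; apply: Ycvg => //; exists B.
rewrite divr_gt0// => /(_ isT) k3.
near=> N.
have N0 : (0 < N)%N by near: N; exists 1%N.
have h3 : `|fine ('E_P'[F \o Ylim k])%E - fine ('E_(P N)[F \o Y k N])%E| <= e / 4 by near: N.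
have [h1 h2] : (\int[P N]_w `|X N w|%:E <= A%:E)%E /\
    forall k, (\int[P N]_w `|X N w - Y k N w|%:E <= (eta k)%:E)%E by near: N.
have := HM _ _ (P N) _ _ _ (mX _ N0) (mY k _ N0) h1 (h2 k).
rewrite /=; move: (fine _) (fine _) (fine _) (fine _) k2 h3 => u v w x.
rewrite !ler_distl; lra.
Unshelve. all: by end_near. Qed.

End comparison.

(** * Test functions and the limiting measure *)

Section plane.
Context {R : realType}.

Lemma open_measurable_plane (U : set (R * R)) : open U -> measurable U.
Proof.
move=> oU.
pose box (q : rat * rat * (rat * rat)) : set (R * R) :=
  `]ratr q.1.1, ratr q.1.2[%classic `*` `]ratr q.2.1, ratr q.2.2[%classic.
have -> : U = \bigcup_q (if `[< box q `<=` U >] then box q else set0).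
  apply/seteqP; split=> [x Ux|x [q _]]; last first.
    by case: asboolP => // qU /qU.
  have /nbhs_ballP[e /= e0 eU] : nbhs x U by exact: open_nbhs_nbhs.
  have [q1] : exists q : rat, (ratr q : R) \in `]x.1 - e, x.1[ by apply: rat_in_itvoo; rewrite ltrBlDr ltrDl.
  have [q2] : exists q : rat, (ratr q : R) \in `]x.1, x.1 + e[ by apply: rat_in_itvoo; rewrite ltrDl.
  have [q3] : exists q : rat, (ratr q : R) \in `]x.2 - e, x.2[ by apply: rat_in_itvoo; rewrite ltrBlDr ltrDl.
  have [q4] : exists q : rat, (ratr q : R) \in `]x.2, x.2 + e[ by apply: rat_in_itvoo; rewrite ltrDl.
  rewrite !in_itv/= => /andP[h41 h42] /andP[h31 h32] /andP[h21 h22] /andP[h11 h12].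
  exists ((q1, q2), (q3, q4)) => //; case: asboolP => [_|[]].
    by split; rewrite /= in_itv/=; apply/andP.
  move=> y [/=]; rewrite !in_itv/= => /andP[y1 y2] /andP[y3 y4]; apply: eU.
  by split; rewrite /ball/= ltr_distl; apply/andP; split; lra.
apply: countable_bigcupT_measurable => // q; case: ifP => // _.
by apply: measurableX; exact: measurable_itv.
Qed.

Lemma bounded_plane (D : set (R * R)) : bounded_set D ->
  exists2 M : nat, (0 < M)%N & forall z, D z -> `|z.1| <= M%:R /\ `|z.2| <= M%:R.
Proof.
move=> /pinfty_ex_gt0[r r0 Dr].
exists (Num.truncn r).+1 => // z /Dr; rewrite /= prod_normE ge_max => /andP[z1 z2].
by split; [apply: le_trans z1 _|apply: le_trans z2 _]; exact/ltW/truncnS_gt.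
Qed.

Lemma compact_closure_plane (D : set (R * R)) : bounded_set D -> compact (closure D).
Proof.
move=> /bounded_plane[M M0 DM].
pose B : set (R * R) := `[- M%:R, M%:R]%classic `*` `[- M%:R, M%:R]%classic.
have cB : compact B by apply: compact_setX; exact: segment_compact.
apply: (subclosed_compact (@closed_closure _ D) cB).
have clB : closed B by apply: compact_closed => //; exact: norm_hausdorff.
rewrite [X in _ `<=` X](closure_id B).1//; apply: closure_subset => z /DM[z1 z2].
by split; rewrite /= in_itv/= -ler_norml.
Qed.

(** Piecewise linear, equal to 1 on [0, k + 1] and to 0 outside of
[-1/(k + 1), k + 2]: a compactly supported approximation of the indicator of
[0, +oo[. *)
Definition bump (k : nat) (y : R) : R :=
  Num.max 0 (Num.min 1 (Num.min (1 + k.+1%:R * y) (k.+2%:R - y))).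

Lemma continuous_bump k : continuous (bump k).
Proof.
have c1 : continuous (fun y : R => 1 + k.+1%:R * y).
  by move=> y; apply: cvgD; [exact: cvg_cst|apply: cvgM; [exact: cvg_cst|exact: cvg_id]].
have c2 : continuous (fun y : R => k.+2%:R - y).
  by move=> y; apply: cvgB; [exact: cvg_cst|exact: cvg_id].
apply: (@max_fun_continuous _ R R (cst 0)); first exact: cst_continuous.
apply: (@min_fun_continuous _ R R (cst 1)); first exact: cst_continuous.
exact: min_fun_continuous.
Qed.

Lemma bump_ge0 k y : 0 <= bump k y.
Proof. by rewrite /bump le_max lexx. Qed.

Lemma bump_le1 k y : bump k y <= 1.
Proof. by rewrite /bump ge_max ler01 ge_min lexx. Qed.

Lemma bump_eq1 k y : 0 <= y <= k.+1%:R -> bump k y = 1.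
Proof.
move=> /andP[y0 yk]; apply/eqP; rewrite eq_le bump_le1 /bump le_max !le_min lexx/=.
apply/orP; right; apply/andP; split; first by rewrite lerDl mulr_ge0.
by rewrite -[k.+2%:R]natr1; lra.
Qed.

Lemma bump_eq0 k y : y <= - k.+1%:R^-1 \/ k.+2%:R <= y -> bump k y = 0.
Proof.
move=> yk; apply/eqP; rewrite eq_le bump_ge0 andbT /bump ge_max lexx !ge_min /=.
apply/orP; right; apply/orP.
case: yk => yk; [left|right]; last by rewrite subr_le0.
have k0 : 0 < k.+1%:R :> R by rewrite ltr0n.
by rewrite addrC -lerBrDr sub0r -ler_pdivlMl// mulrN1.
Qed.

Lemma test_function_bump (D : set (R * R)) k : bounded_set D ->
  test_function (closure D) (fun z => bump k z.2).
Proof.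
move=> bD; split.
  apply: continuous_subspaceT => z.
  by apply: (continuous_comp cvg_snd); exact: continuous_bump.
exists (closure D `*` `[-1, k.+2%:R]%classic); split.
- by apply: compact_setX; [exact: compact_closure_plane|exact: segment_compact].
- by move=> z [].
- move=> z [Dz _] nz; apply: bump_eq0.
  have [z1|z1] := leP z.2 (- k.+1%:R^-1); first by left.
  right; rewrite leNgt; apply/negP => z2; apply: nz; split => //=.
  rewrite in_itv/= (ltW z2) andbT; apply: le_trans (ltW z1).
  by rewrite lerN2 invf_le1 ?ltr0n// ler1n.
Qed.

End plane.

Section sum_dirac_integral.
Context {R : realType} (I : choiceType) d (T : measurableType d).

Lemma sum_diracE (A : set I) (p : I -> T) (B : set T) : finite_set A ->
  sum_dirac A p B = (\sum_(x <- fset_set A) \d_(p x) B)%E :> \bar R.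
Proof.
move=> fA; rewrite /sum_dirac esum_fset//.
by rewrite fsbig_finite.
Qed.

Lemma integral_sum_dirac (A : set I) (p : I -> T) (E : set T) (f : T -> R) :
  finite_set A -> measurable E -> (forall x, A x -> E (p x)) ->
  measurable_fun setT f -> (forall z, 0 <= f z) ->
  (\int[sum_dirac A p]_(z in E) (f z)%:E = (\sum_(x <- fset_set A) f (p x))%:E)%E.
Proof.
move=> fA mE AE mf f0.
have [x0|A0] := pselect (exists x, A x); last first.
  have -> : A = set0 by apply/seteqP; split=> // x Ax; apply: A0; exists x.
  rewrite fset_set0 big_nil; apply: etrans (integral_measure_zero E (EFin \o f)).
  by apply: eq_measure_integral => B _ _; rewrite [LHS]sum_diracE// fset_set0 big_nil.
have [a Aa] := x0.
set s := enum_fset (fset_set A).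
pose m n := \d_(p (nth a s n)) : measure T R.
have mfE : measurable_fun E (fun z => (f z)%:E).
  by apply/measurable_funTS/measurable_EFinP.
rewrite (@eq_measure_integral _ _ _ _ (msum m (size s))); last first.
  move=> B mB _; rewrite [LHS]sum_diracE// /msum/=.
  by rewrite (big_nth a) big_mkord.
rewrite ge0_integral_measure_sum//; last by move=> z _; rewrite lee_fin.
rewrite -sumEFin (big_nth a) big_mkord; apply: eq_bigr => i _.
rewrite integral_dirac// diracE mem_set ?mul1e//; apply: AE.
by have := mem_nth a (ltn_ord i); rewrite -/s in_fset_set// inE.
Qed.

End sum_dirac_integral.

Section counts.
Context {R : realType}.

Lemma scaled_bounds (D : set (R * R)) (M N : nat) (x : Z2) : (0 < N)%N ->
  (forall z, D z -> `|z.1| <= M%:R /\ `|z.2| <= M%:R) ->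
  ((N%:R^-1)%:E < edist_inf (~` D) (scaled N x))%E ->
  D (scaled N x) /\ (`|x.1| <= (M * N)%N%:Z /\ `|x.2| <= (M * N)%N%:Z)%R.
Proof.
move=> N0 DM dx.
have Dx : D (scaled N x).
  apply: contrapT => nDx; move: dx; rewrite edist_inf0// lte_fin ltNge.
  by rewrite invr_ge0 ler0n.
split => //; have [] := DM _ Dx.
have N0' : 0 < N%:R :> R by rewrite ltr0n.
rewrite /scaled /= !normrM !normfV !(ger0_norm (ltW N0')) !ler_pdivrMr//.
rewrite -!natrM -!intr_norm => h1 h2; split.
  by rewrite -(ler_int R).
by rewrite -(ler_int R).
Qed.

(** The approximations have O(N^2) sites. *)
Lemma box_finite (DN : set Z2) (m : nat) :
  (forall x, DN x -> (`|x.1| <= m%:Z /\ `|x.2| <= m%:Z)%R) ->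
  finite_set DN /\ (#|` fset_set DN| <= (m.*2.+1) ^ 2)%N.
Proof.
move=> H.
pose s := [seq ((i%:Z - m%:Z)%R, (j%:Z - m%:Z)%R) | i <- iota 0 m.*2.+1, j <- iota 0 m.*2.+1].
have Ds x : DN x -> x \in s.
  move=> /H; case: x => a b /= [ha hb]; apply/allpairsP.
  exists (absz (a + m%:Z), absz (b + m%:Z)); rewrite !mem_iota /=.
  split; [lia|lia|congr (_, _); lia].
have fD : finite_set DN.
  by apply: (sub_finite_set (B := [set` s])) => [x /Ds|]//; exact: finite_seq.
split => //.
have -> : (m.*2.+1 ^ 2 = size s)%N by rewrite size_allpairs !size_iota expnS expn1.
by apply: uniq_leq_size => // x; rewrite in_fset_set// inE => /Ds.
Qed.

Lemma ncard_sum (DN : set Z2) (Q : Z2 -> bool) : finite_set DN ->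
  (ncard [set x | DN x /\ Q x])%:R = \sum_(x <- fset_set DN) (Q x)%:R :> R.
Proof.
move=> fD; rewrite /ncard.
have fQ : finite_set [set x | DN x /\ Q x] by apply: sub_finite_set fD => x [].
have /perm_size -> : perm_eq (enum_fset (fset_set [set x | DN x /\ Q x]))
    [seq x <- fset_set DN | Q x].
  apply: uniq_perm; rewrite ?filter_uniq//= => x.
  rewrite mem_filter !in_fset_set//; apply/idP/andP.
    by rewrite !inE => -[Dx Qx].
  by rewrite !inE => -[Qx Dx].
rewrite size_filter -sum1_count natr_sum big_mkcond/=; apply: eq_bigr => x _.
by case: (Q x).
Qed.

(** On test functions of the height only, the point measure is a weighted count. *)
Lemma test_integral_thick (D : set (R * R)) (DN : set Z2) (a : nat -> R) (N : nat)
    (h : Z2 -> R) k (tk : test_function (closure D) (fun z => bump k z.2)) :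
  finite_set DN -> (forall x, DN x -> D (scaled N x)) ->
  test_integrals (thick_point_measure DN a N h : measure3) (exist _ _ tk) =
  (KN a N)^-1 * \sum_(x <- fset_set DN) bump k (h x - a N).
Proof.
move=> fD DD.
have mE : measurable (closure D `*` [set: R]).
  apply: measurableX => //; rewrite -[X in measurable X]setCK; apply: measurableC.
  by apply: open_measurable_plane; apply: closed_openC; exact: closed_closure.
have mf : measurable_fun [set: R * R * R] (fun z => bump k z.2).
  by apply: measurableT_comp => //; apply: continuous_measurable_fun; exact: continuous_bump.
rewrite /test_integrals /Rintegral /thick_point_measure ge0_integral_mscale//=; last 2 first.
- by apply/measurable_funTS/measurable_EFinP.
- by move=> z _; rewrite lee_fin bump_ge0.
rewrite integral_sum_dirac//.
- by move=> x Dx; split => //=; apply: subset_closure; exact: DD.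
- by move=> z; exact: bump_ge0.
Qed.

Lemma bump_approx k (y : R) : `|(0 <= y)%R%:R - bump k y| <=
  (- k.+1%:R^-1 <= y < 0)%R%:R + (k.+1%:R <= y)%R%:R.
Proof.
have b0 := bump_ge0 k y; have b1 := bump_le1 k y.
have [y0|y0] := leP 0 y.
  rewrite andbF add0r; have [yk|yk] := leP k.+1%:R y.
    by rewrite ger0_norm ?subr_ge0//; lra.
  by rewrite bump_eq1 ?subrr ?normr0// y0 ltW.
rewrite andbT sub0r normrN ger0_norm//.
have [yk|yk] := leP (- k.+1%:R^-1) y; first by rewrite ler_wpDr// .
rewrite bump_eq0; last by left; exact: ltW.
by rewrite addr_ge0.
Qed.

Lemma mean_sum_le d (Omega : measurableType d) (P : probability Omega R)
    (s : seq Z2) (h : Z2 -> {RV P >-> R}) (I : interval R) (q : R) :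
  (forall x, x \in s -> (P (h x @^-1` [set` I]) <= q%:E)%E) ->
  (\int[P]_w (\sum_(x <- s) (h x w \in I)%:R)%:E <= ((size s)%:R * q)%:E)%E.
Proof.
move=> Pq.
have mA x : measurable (h x @^-1` [set` I]).
  by rewrite -[X in measurable X]setTI; apply: (@measurable_funPT _ _ _ _ (h x)) => //; exact: measurable_itv.
have -> : (\int[P]_w (\sum_(x <- s) (h x w \in I)%:R)%:E =
    \int[P]_w (\sum_(x <- s) (\1_(h x @^-1` [set` I]) w)%:E))%E.
  apply: eq_integral => w _; rewrite sumEFin; congr EFin.
  by apply: eq_bigr => x _; rewrite indicE mem_setE.
rewrite ge0_integral_sum//; last first.
  by move=> x; apply/measurable_EFinP; exact: measurable_indic.
under eq_bigr => x _ do rewrite integral_indic// setIT.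
apply: (@le_trans _ _ (\sum_(x <- s) q%:E)%E).
  by rewrite big_seq [leRHS]big_seq; apply: lee_sum => x; exact: Pq.
by rewrite sumEFin big_const_seq count_predT iter_addr_0 mulr_natl.
Qed.

End counts.

Section limit_integral.
Context {R : realType}.

Definition bump_mass (c : R) (k : nat) : R :=
  fine (\int[exp_measure c]_y (bump k y)%:E)%E.

Lemma exp_measure_tail (c u : R) : 0 < c ->
  exp_measure c `[u, +oo[%classic = (expR (- (c * u)) / c)%:E.
Proof. by move=> c0; rewrite /exp_measure integral_expR_tail. Qed.

Lemma measurable_bump k : measurable_fun [set: R] (fun y : R => (bump k y)%:E).
Proof.
by apply/measurable_EFinP; apply: continuous_measurable_fun; exact: continuous_bump.
Qed.

Lemma integral_bump_ge (nu : {measure set R -> \bar R}) k :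
  (nu `[0%R, k.+1%:R[%classic <= \int[nu]_y (bump k y)%:E)%E.
Proof.
have -> : (nu `[0%R, k.+1%:R[%classic = \int[nu]_y (\1_(`[0%R, k.+1%:R[%classic) y)%:E)%E.
  by rewrite integral_indic// setIT.
apply: ge0_le_integral => //.
- by apply/measurable_EFinP; exact: measurable_indic.
- exact: measurable_bump.
- move=> y _; rewrite lee_fin indicE mem_setE in_itv/=.
  case: (boolP (0 <= y < k.+1%:R)) => [/andP[y0 yk]|_]; last exact: bump_ge0.
  by rewrite bump_eq1// y0 ltW.
Qed.

Lemma integral_bump_le (nu : {measure set R -> \bar R}) k :
  (\int[nu]_y (bump k y)%:E <= nu `[(- k.+1%:R^-1)%R, +oo[%classic)%E.
Proof.
have -> : (nu `[(- k.+1%:R^-1)%R, +oo[%classic =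
    \int[nu]_y (\1_(`[(- k.+1%:R^-1)%R, +oo[%classic) y)%:E)%E.
  by rewrite integral_indic// setIT.
apply: ge0_le_integral => //.
- by move=> y _; rewrite lee_fin bump_ge0.
- exact: measurable_bump.
- by apply/measurable_EFinP; exact: measurable_indic.
- move=> y _; rewrite lee_fin indicE mem_setE in_itv/= andbT.
  case: (boolP (_ <= y)) => [_|]; first exact: (bump_le1 k y).
  by rewrite -ltNge => yk; rewrite bump_eq0//; left; exact: ltW.
Qed.

Lemma bump_massE (c : R) k : 0 < c ->
  (\int[exp_measure c]_y (bump k y)%:E = (bump_mass c k)%:E)%E.
Proof.
move=> c0; rewrite /bump_mass fineK// ge0_fin_numE; last first.
  by apply: integral_ge0 => y _; rewrite lee_fin bump_ge0.
by apply: le_lt_trans (integral_bump_le _ _) _; rewrite [ltLHS](exp_measure_tail _ c0) ltry.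
Qed.

Lemma exp_measure_itv (c u : R) : 0 < c -> 0 <= u ->
  exp_measure c `[0%R, u[%classic = ((1 - expR (- (c * u))) / c)%:E.
Proof.
move=> c0 u0.
have : exp_measure c `[0%R, +oo[%classic =
    (exp_measure c `[0%R, u[%classic + exp_measure c `[u, +oo[%classic)%E.
  rewrite -measureU//; first by rewrite -itv_bndbnd_setU// bnd_simp.
  apply/seteqP; split=> // y [/=]; rewrite !in_itv/= andbT => /andP[_].
  by rewrite ltNge => /negP.
rewrite !exp_measure_tail// mulr0 oppr0 expR0.
have : (0 <= exp_measure c `[0%R, u[%classic)%E by exact: measure_ge0.
case: (exp_measure c _) => [r _| |]//.
by rewrite -EFinD => -[e]; rewrite mulrBl e addrK.
Qed.

Lemma bump_mass_bounds (c : R) k : 0 < c ->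
  (1 - expR (- (c * k.+1%:R))) / c <= bump_mass c k <= expR (c / k.+1%:R) / c.
Proof.
move=> c0; apply/andP; split; rewrite -lee_fin -bump_massE//.
  by apply: le_trans (integral_bump_ge _ _); rewrite [leRHS](exp_measure_itv c0).
apply: le_trans (integral_bump_le _ _) _; rewrite [leLHS](exp_measure_tail _ c0).
by rewrite mulrN opprK.
Qed.

Lemma cvg_expRN_nat (c : R) : 0 < c -> expR (- (c * k.+1%:R)) @[k --> \oo] --> (0 : R).
Proof.
move=> c0.
have h : c * k.+1%:R @[k --> \oo] --> +oo.
  apply/cvgryPge => A; near=> k; rewrite mulrC -ler_pdivrMr//.
  apply: (@le_trans _ _ k%:R); last by rewrite ler_nat.
  by near: k; exact: nbhs_infty_ger.
exact: (cvg_comp _ _ h (@cvgr_expR R)).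
Unshelve. all: by end_near. Qed.

Lemma bump_mass_cvg (c : R) : 0 < c -> bump_mass c k @[k --> \oo] --> c^-1.
Proof.
move=> c0.
have ck : k.+1%:R^-1 @[k --> \oo] --> (0 : R) by exact: cvg_harmonic.
apply: (@squeeze_cvgr _ _ _ _ (fun k => (1 - expR (- (c * k.+1%:R))) / c)
   (fun k => expR (c / k.+1%:R) / c)).
- by apply: nearW => k; exact: bump_mass_bounds.
- rewrite -[X in _ --> X]mul1r; apply: cvgM; last exact: cvg_cst.
  rewrite -[X in _ --> X]subr0; apply: cvgB; first exact: cvg_cst.
  exact: cvg_expRN_nat.
- rewrite -[X in _ --> X]mul1r; apply: cvgM; last exact: cvg_cst.
  rewrite -[X in _ --> X]expR0.
  apply: continuous_cvg; first exact: continuous_expR.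
  by rewrite -(mulr0 c); apply: cvgM => //; exact: cvg_cst.
Qed.

(** Both sides vanish when zeta has infinite mass, by the convention for fine; the
identity then holds pointwise and not only almost surely. *)
Lemma test_integral_product (D : set (R * R)) (zeta : {measure set (R * R) -> \bar R})
   (c : R) k (tk : test_function (closure D) (fun z => bump k z.2)) : 0 < c ->
  open D -> zeta (~` D) = 0%E ->
  test_integrals ((zeta \x exp_measure c)%E : measure3) (exist _ _ tk) =
  fine (zeta D) * bump_mass c k.
Proof.
move=> c0 oD zD.
have mD : measurable D by exact: open_measurable_plane.
have mK : measurable (closure D).
  rewrite -[X in measurable X]setCK; apply: measurableC.
  by apply: open_measurable_plane; apply: closed_openC; exact: closed_closure.
have mE : measurable (closure D `*` [set: R]) by exact: measurableX.
have mf : measurable_fun [set: R * R * R] (fun z => (bump k z.2)%:E).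
  apply/measurable_EFinP; apply: measurableT_comp => //.
  by apply: continuous_measurable_fun; exact: continuous_bump.
set mu := (zeta \x exp_measure c)%E.
have zT : zeta setT = zeta D.
  rewrite -(setUv D) measureU0//; exact: measurableC.
have zK : zeta (~` closure D) = 0%E.
  apply: (subset_measure0 _ _ _ zD); [exact: measurableC|exact: measurableC|].
  by apply: subsetC; exact: subset_closure.
have muE B : measurable B -> mu (setT `*` B) = (zeta D * exp_measure c B)%E.
  by move=> mB; rewrite [LHS]product_measure1E// zT.
have muN : mu (~` (closure D `*` setT)) = 0%E.
  have -> : ~` (closure D `*` [set: R]) = (~` closure D) `*` setT.
    by apply/seteqP; split=> z /= h; [split=> // h'; apply: h|move=> [h' _]; case: h => + _; apply].
  rewrite [LHS]product_measure1E//; last exact: measurableC.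
  by rewrite [X in (X * _)%E]zK mul0e.
rewrite /test_integrals /Rintegral /=.
have -> : (\int[mu]_(z in closure D `*` [set: R]) (bump k z.2)%:E = \int[mu]_z (bump k z.2)%:E)%E.
  rewrite [RHS](@ge0_negligible_integral _ _ _ _ _ (~` (closure D `*` [set: R])))//.
  - by rewrite setTD setCK.
  - exact: measurableC.
  - by move=> z _; rewrite lee_fin bump_ge0.
have -> : (\int[mu]_z (bump k z.2)%:E = \int[pushforward mu snd]_y (bump k y)%:E)%E.
  rewrite ge0_integral_pushforward//.
  - exact: measurable_bump.
  - by move=> y _; rewrite lee_fin bump_ge0.
have nuE B : measurable B -> pushforward mu snd B = (zeta D * exp_measure c B)%E.
  move=> mB; rewrite -(muE _ mB).
  have e : snd @^-1` B = [set: R * R] `*` B by apply/seteqP; split=> z /=; [|move=> []].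
  by rewrite -e.
have [zfin|zinf] := boolP (zeta D \is a fin_num); last first.
  have zoo : zeta D = +oo%E.
    by move: zinf; rewrite ge0_fin_numE// -leNgt leye_eq => /eqP.
  rewrite zoo mul0r.
  suff -> : (\int[pushforward mu snd]_y (bump k y)%:E = +oo)%E by [].
  apply/eqP; rewrite -leye_eq; apply: le_trans (integral_bump_ge _ k).
  rewrite [leRHS]nuE// zoo [X in (_ <= _ * X)%E](exp_measure_itv c0)// gt0_mulye//.
  by rewrite lte_fin divr_gt0// subr_gt0 -expR0 ltr_expR oppr_lt0 mulr_gt0.
rewrite (@eq_measure_integral _ _ _ _ (mscale (NngNum (fine_ge0 (measure_ge0 zeta D))) (exp_measure c))); last first.
  by move=> B mB _; rewrite [LHS]nuE// -[in LHS](fineK zfin).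
rewrite ge0_integral_mscale//=.
- by rewrite bump_massE// fineM.
- exact: measurable_bump.
- by move=> y _; rewrite lee_fin bump_ge0.
Qed.

End limit_integral.

(** * The first moment of the number of high points *)

Section tails_of_the_field.
Context {R : realType}.

(** Summed over the O(N^2) sites and divided by K_N, the first bound shows that
little mass escapes to height +oo, and the second that little mass lies just
below height 0. *)
Lemma DGFF_tails (DN : nat -> set Z2) (a : nat -> R) (lambda : R)
    (d : nat -> measure_display) (Omega : forall N, measurableType (d N))
    (P : forall N, probability (Omega N) R)
    (h : forall N, Z2 -> {RV (P N) >-> R}) (M : nat) :
  (forall N, (0 < N)%N -> DGFF (DN N) (h N)) ->
  (forall N x, (0 < N)%N -> DN N x -> `|x.1| <= (M * N)%N%:Z /\ `|x.2| <= (M * N)%N%:Z) ->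
  0 < lambda < 1 -> level_sequence lambda a ->
  exists c C : R, [/\ 0 < c, 0 < C &
    \forall N \near \oo, forall x, DN N x ->
      (forall u, -1 <= u -> (P N (h N x @^-1` `[(a N + u)%R, +oo[) <=
         (C * (KN a N / N%:R ^+ 2) * (expR (- (c * u)) / c))%:E)%E) /\
      (forall e, 0 < e <= 1 -> (P N (h N x @^-1` `[(a N - e)%R, a N[) <=
         (C * (KN a N / N%:R ^+ 2) * expR c * e)%:E)%E)].
Proof.
move=> hDGFF DNM l01 la.
pose C0 : R := (1 + 3 / pi + 2 * (2 * M%:R ^+ 2) / pi) / 4.
have C00 : 0 <= C0.
  by rewrite divr_ge0// !addr_ge0// ?divr_ge0 ?mulr_ge0 ?exprn_ge0 ?pi_ge0.
have [c [C [c0 C_gt0 near_density]]] := thick_density_le l01 la C00.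
exists c, C; split => //; near=> N => x Dx.
have N0 : (0 < N)%N by near: N; exists 1%N.
have [aN1 dens] : 1 < a N /\ forall s y : R, s != 0 ->
      s ^+ 2 <= gconst R * ln N%:R + C0 -> -1 <= y ->
      normal_pdf 0 s (a N + y) <= C * (KN a N / N%:R ^+ 2) * expR (- (c * y)) by near: N.
have [G GD [gauss E0 covG]] := hDGFF N N0.
have [m [s [s0 law']]] := gauss 1%N (fun=> x) (fun=> 1) (fun=> Dx).
have law A : measurable A -> P N (h N x @^-1` A) = normal_law m s A.
  move=> mA; rewrite -law'//; congr (P N _); congr (_ @^-1` A).
  by apply/funext => w; rewrite big_ord1 mul1r.
have [m0 sG] := centered_normal_law law (E0 x Dx) (covG x x Dx Dx).
rewrite m0 in law.
have GN : G x x <= gconst R * ln N%:R + C0.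
  apply: (green_function_diag_le GD N0) => // y Dy; have [h1 h2] := DNM N y N0 Dy.
  have sq (j : int) : `|j| <= (M * N)%N%:Z -> j%:~R ^+ 2 <= (M%:R * N%:R) ^+ 2 :> R.
    move=> jM; rewrite -real_normK ?num_real// ler_sqr ?nnegrE ?mulr_ge0//.
    by rewrite -intr_norm -natrM -(ler_int R) in jM *.
  by have := sq _ h1; have := sq _ h2; rewrite exprMn; lra.
have sV := le_trans sG GN.
have KN0 : 0 <= KN a N by rewrite mulr_ge0 ?expR_ge0// divr_ge0 ?exprn_ge0 ?sqrtr_ge0.
have M0 : 0 <= C * (KN a N / N%:R ^+ 2) by rewrite mulr_ge0 ?(ltW C_gt0)// divr_ge0// exprn_ge0.
have dens' : s != 0 -> forall y, -1 <= y ->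
    normal_pdf 0 s (a N + y) <= C * (KN a N / N%:R ^+ 2) * expR (- (c * y)).
  by move=> sn0 y y1; exact: dens.
split => [u u1|e e01].
  exact: (normal_upper_tail law aN1 M0 c0 dens' u1).
exact: (normal_below law aN1 M0 c0 dens' e01).
Unshelve. all: by end_near. Qed.

Lemma continuous_test_integral (K : set (R * R)) (f : test_functions K) :
  continuous (fun mu : vague K => test_integrals (mu : measure3) f).
Proof.
move=> mu.
apply: (@continuous_comp _ _ _ (@test_integrals R K : vague K -> {ptws test_functions K -> R})
  (fun g : {ptws test_functions K -> R} => g f)).
  exact: initial_continuous.
exact: (@proj_continuous _ (fun=> R) f).
Qed.

End tails_of_the_field.

(** * Convergence of the number of high points *)
Theorem corollary1p6 (R : realType) (D : set (R * R)) (DN : nat -> set Z2)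
    (a : nat -> R) (lambda : R)
    (d : nat -> measure_display) (Omega : forall N, measurableType (d N))
    (P : forall N, probability (Omega N) R)
    (h : forall N, Z2 -> {RV (P N) >-> R})
    (d' : measure_display) (Omega' : measurableType d')
    (P' : probability Omega' R) (Z : R.-ker Omega' ~> (R * R)%type) :
  admissible_domain D ->
  admissible_approx D DN ->
  (forall N, (0 < N)%N -> DGFF (DN N) (h N)) ->
  0 < lambda < 1 ->
  level_sequence lambda a ->
  is_ZD D lambda P' Z ->
  cvg_in_law [set: R] P
    (fun N w => (KN a N)^-1 * (ncard [set x | DN N x /\ a N <= h N x w])%:R)
    P' (fun w => (alphac R * lambda)^-1 * fine (Z w D)).
Proof.
move=> [bD oD _ _] aDN hDGFF l01 la [ZD0 _ ZDcvg].
have [M M0 DM] := bounded_plane bD.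
have inD N x : (0 < N)%N -> DN N x -> D (scaled N x) /\
    (`|x.1| <= (M * N)%N%:Z /\ `|x.2| <= (M * N)%N%:Z).
  by move=> N0 Dx; apply: scaled_bounds => //; case: aDN => _ /(_ N N0) H _; exact: H.
have DNM N x : (0 < N)%N -> DN N x -> `|x.1| <= (M * N)%N%:Z /\ `|x.2| <= (M * N)%N%:Z.
  by move=> N0 Dx; have [] := inD N x N0 Dx.
have fin N : (0 < N)%N -> finite_set (DN N) /\
    (#|` fset_set (DN N)| <= (M * N).*2.+1 ^ 2)%N.
  by move=> N0; apply: box_finite => x; exact: DNM.
have [c [C [c0 C0 tails]]] := DGFF_tails hDGFF DNM l01 la.
have beta0 : 0 < alphac R * lambda.
  by rewrite mulr_gt0 ?divr_gt0 ?sqrtr_gt0 ?gconst_gt0//; case/andP: l01.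
set beta := alphac R * lambda in beta0 *.
have mD : measurable D by exact: open_measurable_plane.
have mZ : measurable_fun setT (fun w => fine (Z w D)).
  by apply: measurableT_comp => //; exact: measurable_kernel.
pose Y k N (w : Omega N) := (KN a N)^-1 * \sum_(x <- fset_set (DN N)) bump k (h N x w - a N).
pose Ylim k w := fine (Z w D) * bump_mass beta k.
pose S : R := 9 * M%:R ^+ 2.
have S0 : 0 < S by rewrite mulr_gt0// exprn_gt0// ltr0n.
pose eta k : R := S * C * (expR c * k.+1%:R^-1 + expR (- (c * k.+1%:R)) / c).
have XE N w : (0 < N)%N -> (KN a N)^-1 * (ncard [set x | DN N x /\ a N <= h N x w])%:R =
    (KN a N)^-1 * \sum_(x <- fset_set (DN N)) (h N x w \in `[a N, +oo[)%:R.
  move=> N0; congr (_ * _); rewrite (ncard_sum (fun x => a N <= h N x w)); last by have [] := fin N N0.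
  by apply: eq_bigr => x _; rewrite in_itv/= andbT.
have mind N x (I : interval R) : measurable_fun setT (fun w => (h N x w \in I)%:R : R).
  have -> : (fun w => (h N x w \in I)%:R : R) = \1_(h N x @^-1` [set` I]).
    by apply/funext => w; rewrite indicE mem_setE.
  apply: measurable_indic; rewrite -[X in measurable X]setTI.
  by apply: (@measurable_funPT _ _ _ _ (h N x)) => //; exact: measurable_itv.
have mX N : (0 < N)%N -> measurable_fun setT (fun w : Omega N =>
    (KN a N)^-1 * (ncard [set x | DN N x /\ a N <= h N x w])%:R).
  move=> N0; apply: (eq_measurable_fun (fun w => (KN a N)^-1 *
     \sum_(x <- fset_set (DN N)) (h N x w \in `[a N, +oo[)%:R)).
    by move=> w _; rewrite XE.
  by apply: measurable_funM => //; apply: measurable_sum.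
have mY k N : measurable_fun setT (Y k N).
  apply: measurable_funM => //; apply: measurable_sum => x.
  apply: measurableT_comp; last exact: measurable_funB.
  by apply: continuous_measurable_fun; exact: continuous_bump.
apply: (@cvg_in_law_approx R d Omega P _ Y d' Omega' P' _ Ylim (S * C / c) eta).
- exact: mX.
- by move=> k N _; exact: mY.
- exact: measurable_funM.
- by move=> k; exact: measurable_funM.
- move=> w; rewrite mulrC; apply: cvgM; [exact: cvg_cst|exact: bump_mass_cvg].
- move=> F cF [B FB] k.
  have tk := test_function_bump k bD.
  pose f : test_functions (closure D) := exist _ _ tk.
  pose F' (mu : vague (closure D)) := F (test_integrals (mu : measure3) f).
  have := ZDcvg DN a d Omega P h aDN la hDGFF F'.
  have -> : F' \o (fun w => (Z w \x exp_measure (alphac R * lambda))%E : measure3) = F \o Ylim k.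
    by apply/funext => w; rewrite /F' /= test_integral_product.
  move=> H; apply: cvg_trans (H _ _).
  + apply: near_eq_cvg; near=> N; congr expectation; apply/funext => w.
    have N0 : (0 < N)%N by near: N; exists 1%N.
    rewrite /F' /= test_integral_thick//; first by have [] := fin N N0.
    by move=> x Dx; have [] := inD N x N0 Dx.
  + apply: continuous_subspaceT => mu; apply: (continuous_comp (@continuous_test_integral R _ f mu)).
    exact: cF.
  + by exists B => m _; exact: FB.
- by rewrite divr_gt0// mulr_gt0.
- near=> N.
  have N0 : (0 < N)%N by near: N; exists 1%N.
  have tl : forall x, DN N x ->
      (forall u, -1 <= u -> (P N (h N x @^-1` `[(a N + u)%R, +oo[) <=
         (C * (KN a N / N%:R ^+ 2) * (expR (- (c * u)) / c))%:E)%E) /\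
      (forall e, 0 < e <= 1 -> (P N (h N x @^-1` `[(a N - e)%R, a N[) <=
         (C * (KN a N / N%:R ^+ 2) * expR c * e)%:E)%E) by near: N.
  have L1 : 1 <= ln N%:R :> R by near: N; exact: near_ln_ge.
  have N0' : 0 < N%:R :> R by rewrite ltr0n.
  have K0 : 0 < KN a N.
    rewrite mulr_gt0 ?expR_gt0// divr_gt0 ?exprn_gt0// sqrtr_gt0.
    exact: lt_le_trans L1.
  have [fD szD] := fin N N0.
  set s := enum_fset (fset_set (DN N)).
  have sD x : x \in s -> DN N x by rewrite in_fset_set// inE.
  have sz : (size s)%:R <= S * N%:R ^+ 2.
    apply: (@le_trans _ _ (((M * N).*2.+1) ^ 2)%:R); first by rewrite ler_nat.
    rewrite /S -mulrA -exprMn -natrM natrX.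
    rewrite (_ : 9 * (M * N)%:R ^+ 2 = (3 * (M * N)%:R) ^+ 2 :> R); last by rewrite exprMn; ring.
    rewrite ler_sqr ?nnegrE ?mulr_ge0// -(natrM R 3) ler_nat -addnn.
    have : (0 < M * N)%N by rewrite muln_gt0 M0.
    by move: (M * N)%N; clear=> m m0; lia.
  pose T (I : interval R) := (\int[P N]_w (\sum_(x <- s) (h N x w \in I)%:R)%:E)%E.
  have TE I q : (forall x, DN N x -> (P N (h N x @^-1` [set` I]) <=
      (C * (KN a N / N%:R ^+ 2) * q)%:E)%E) -> 0 <= q ->
      (((KN a N)^-1)%:E * T I <= (S * C * q)%:E)%E.
    move=> Hq q0; have := @mean_sum_le R _ _ (P N) s (h N) I _ (fun x xs => Hq x (sD x xs)).
    move=> /(lee_wpmul2l (_ : 0 <= ((KN a N)^-1)%:E)%E) H.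
    apply: le_trans (H _) _; first by rewrite lee_fin invr_ge0 ltW.
    rewrite -EFinM lee_fin ler_pdivrMl//.
    apply: (@le_trans _ _ (S * N%:R ^+ 2 * (C * (KN a N / N%:R ^+ 2) * q))).
      by rewrite ler_wpM2r// mulr_ge0// mulr_ge0 ?(ltW C0)// divr_ge0 ?(ltW K0)// exprn_ge0.
    by rewrite le_eqVlt; apply/orP; left; apply/eqP; field; rewrite gt_eqF.
  have mT (I : interval R) : measurable_fun setT (fun w => (\sum_(x <- s) (h N x w \in I)%:R)%:E : \bar R).
    by apply/measurable_EFinP; exact: measurable_sum.
  have T0 (I : interval R) w : (0 <= (\sum_(x <- s) (h N x w \in I)%:R)%:E :> \bar R)%E.
    by rewrite lee_fin sumr_ge0.
  split.
  + have -> : (\int[P N]_w `|(KN a N)^-1 * (ncard [set x | DN N x /\ a N <= h N x w])%:R|%:E =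
        ((KN a N)^-1)%:E * T `[a N, +oo[)%E.
      rewrite -ge0_integralZl//; last by rewrite lee_fin invr_ge0 ltW.
      apply: eq_integral => w _; rewrite XE// -EFinM ger0_norm// mulr_ge0 ?invr_ge0 ?(ltW K0)//.
      by rewrite sumr_ge0.
    apply: TE; last by rewrite invr_ge0 ltW.
    move=> x Dx; have [/(_ 0) + _] := tl x Dx.
    by rewrite addr0 mulr0 oppr0 expR0 div1r; apply; rewrite lerN10.
  + move=> k.
    have k1 : 0 < (k.+1%:R^-1 : R) <= 1 by rewrite invr_gt0 ltr0n/= invf_le1 ?ltr0n// ler1n.
    pose I1 := `[a N - k.+1%:R^-1, a N[; pose I2 := `[a N + k.+1%:R, +oo[.
    apply: (@le_trans _ _ (((KN a N)^-1)%:E * T I1 + ((KN a N)^-1)%:E * T I2)%E).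
      rewrite -!ge0_integralZl ?lee_fin ?invr_ge0 ?(ltW K0)//.
      rewrite -ge0_integralD//; last 4 first.
      * by move=> w _; rewrite mule_ge0// lee_fin invr_ge0 ltW.
      * exact: emeasurable_funM.
      * by move=> w _; rewrite mule_ge0// lee_fin invr_ge0 ltW.
      * exact: emeasurable_funM.
      apply: ge0_le_integral => //=.
      * apply/measurable_EFinP; apply: measurableT_comp => //.
        by apply: measurable_funB; [exact: mX|exact: mY].
      * by apply: emeasurable_funD; exact: emeasurable_funM.
      * move=> w _; rewrite XE// /Y -!EFinM -EFinD lee_fin -mulrBr normrM.
        rewrite ger0_norm ?invr_ge0 ?(ltW K0)// -mulrDr ler_wpM2l ?invr_ge0 ?(ltW K0)//.
        rewrite -sumrB -big_split/=; apply: le_trans (ler_norm_sum _ _ _) _.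
        apply: ler_sum => x _; have := bump_approx k (h N x w - a N).
        rewrite !in_itv/= andbT subr_ge0 subr_lt0 lerBrDl lerBrDr.
        by rewrite andbT [k.+1%:R + _]addrC.
    rewrite /eta mulrDr EFinD; apply: leeD; apply: TE.
    * by move=> x Dx; rewrite mulrA; have [_] := tl x Dx; exact.
    * by rewrite mulr_ge0 ?expR_ge0// invr_ge0.
    * move=> x Dx; have [+ _] := tl x Dx; apply; exact: le_trans (ler0n _ _).
    * by rewrite divr_ge0 ?expR_ge0 ?(ltW c0).
- rewrite -(mulr0 (S * C)); apply: cvgM; first exact: cvg_cst.
  rewrite -[X in _ --> X]addr0; apply: cvgD.
    rewrite -(mulr0 (expR c)); apply: cvgM; [exact: cvg_cst|exact: cvg_harmonic].
  by rewrite -(mul0r c^-1); apply: cvgM; [exact: cvg_expRN_nat|exact: cvg_cst].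
Unshelve. all: by end_near. Qed.
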